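(* The integer $22$ is the only Perrin number that is a palindromic concatenation of two repdigits, where a Perrin number $P_n$ is called a palindromic concatenation of two repdigits if $$P_n=\overline{\underbrace{d_1\ldots d_1}_{\ell\text{ times}}\underbrace{d_2\ldots d_2}_{m\text{ times}}\underbrace{d_1\ldots d_1}_{\ell\text{ times}}}$$ for some integers $\ell,m\ge 1$ and digits $d_1,d_2\in\{0,1,2,\ldots,9\}$ with $d_1>0$.
   Context: The Perrin sequence $(P_n)_{n\ge 0}$ is defined by $P_0=3$, $P_1=0$, $P_2=2$ and $P_{n+3}=P_{n+1}+P_n$ for all $n\ge 0$. A repdigit (in base 10) is a number $d\left(\frac{10^{k}-1}{9}\right)$ consisting of $k\ge 1$ repetitions of a single digit $d$, $0\le d\le 9$. The overline denotes base-10 concatenation of digits: $\ell$ copies of $d_1$, followed by $m$ copies of $d_2$, followed by $\ell$ copies of $d_1$; equivalently, $$P_n=\frac{1}{9}\left(d_1\cdot 10^{2\ell+m}-(d_1-d_2)\cdot 10^{\ell+m}+(d_1-d_2)\cdot 10^{\ell}-d_1\right).$$ No condition $d_1\ne d_2$ is imposed.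
   Formalization: The English requires m ≥ 1, but then the number has at least 3 digits, so 22 is not of the stated form; the formal statement allows m ≥ 0 (an empty middle block), under which 22 (ℓ=1, m=0, d_1=2) is the only such Perrin number. *)

(* Defs.v *)
From mathcomp Require Import all_boot.
Set Implicit Arguments.
Unset Strict Implicit.
Unset Printing Implicit Defensive.

Fixpoint perrin (n : nat) : nat :=
  match n with
  | 0 => 3
  | 1 => 0
  | 2 => 2
  | (k.+1 as k1).+2 => perrin k1 + perrin k
  end.

(* Most significant digit first. *)
Definition decimal_value (s : seq 'I_10) : nat :=
  foldl (fun (a : nat) (d : 'I_10) => 10 * a + d) 0 s.

(* The middle block may be empty (m = 0): 22 has two digits, so it is of this
   form only with l = 1 and m = 0; with m >= 1 the number has at least three
   digits.  The case m >= 1 is included, and d1 = d2 is allowed. *)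
Definition palindromic_concatenation (N : nat) : Prop :=
  exists (l m : nat) (d1 d2 : 'I_10),
    [/\ 1 <= l, 0 < d1 &
        N = decimal_value (nseq l d1 ++ nseq m d2 ++ nseq l d1)].

(* Main.v *)
From Stdlib Require Import PArith NArith.
Require Import Defs.
From mathcomp Require Import all_boot all_order all_algebra.
From mathcomp Require Import zify ring lra.
From mathcomp Require Import boolp classical_sets reals topology normedtype sequences exp.
Set Implicit Arguments. Unset Strict Implicit. Unset Printing Implicit Defensive.
Import Order.TTheory GRing.Theory Num.Theory.
Import numFieldNormedType.Exports.
Local Open Scope ring_scope.

(** A congruence sieve on [n] and on the two block lengths [l], [m] leaves only
    the digits 9, 8 with [n = -1, -7, -11, -29] modulo 21000; this class cannot be
    sieved away because [P_n = -1] at these four negative indices, which the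
    formula reproduces for [l = -1], [m = 1].  In the remaining class [5^l] divides
    [P_n + 1], so [5^(l-1)] divides [n + nu] with [nu] in [{1, 7, 11, 29}]: hence
    [l = O(log n)], and further congruences give [l >= 1499].

    With [x] the real root of [x^3 = x + 1] and [A = 9 * 10^l - 1] the equation
    makes [9 x^n / (A 10^(l+m))] exponentially close to 1 in [n], and Baker's
    method excludes this.  Siegel's lemma gives integers [p(r,s,t)], not all zero,
    such that [sum p(r,s,t) X^i Y^j W^k = 0] for small [i], [j], [k], where
    [X = r + t n], [Y = s - t (l+m)], [W = x^r 10^s A^t 9^(T-t)].  As [log W] is
    almost a linear form in [X] and [Y], a Schwarz lemma makes the same sums tiny
    for larger [k], and the norm from [Q(x)] then forces them to vanish.  After
    seven such steps there are enough values of [k] for a Vandermonde argument,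
    which gives [p = 0]. *)

(** * A Schwarz lemma for polynomials *)

(** The bound [l = O(log n)] is what makes [A] usable as a base: its bit length is of order [l], so
    [T * l <= S] keeps [A^t] no larger than the powers of 10 in the box. Replacing [A] by
    [9 x^n / 10^(l+m)] turns [log W] into [T ln 9 + X ln x + Y ln 10], up to a tiny multiple of [t];
    the factor [9^(T-t)] is there to make the coefficient of [ln 9] constant. Thus three free
    exponents feed a form in two variables: [S^2 T] unknowns face about [D^2 K0] conditions, which
    is solvable for [D] of order [S Q] once [T] is of order [K0 Q^2]. One step multiplies the range
    of [k] by [Q] and costs [d = D/8] orders of vanishing. With [S = T l] the number of unknowns is
    [T^3 l^2], about [Q^6], so the range [Q^7 K0] after seven steps exceeds it. The whole argument
    tolerates an error [2^(-Q^11)]; since the true error is exponentially small in [n], taking [n]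
    of size [Q^12] suffices, hence [Q = 2^w] with [w] about [log2 n / 12]. Only real numbers occur:
    a coefficient norm replaces the maximum modulus, truncated exponential series replace entire
    functions, and an explicit cofactor of the norm replaces the complex conjugates. *)

Section WeightedNorm.
Variable R : realFieldType.
Implicit Types (p q : {poly R}) (rho a : R).

(** The weighted coefficient norm: the sum of the [|p_i| rho^i]. It bounds [p] on [[-rho, rho]] and
    plays the role of the maximum modulus on a disc. *)
Definition wnorm rho p := (map_poly (fun x : R => `|x|) p).[rho].

Lemma wnormE rho p n : (size p <= n)%N ->
  wnorm rho p = \sum_(i < n) `|p`_i| * rho ^+ i.
Proof.
move=> sp; rewrite /wnorm (@horner_coef_wide _ n); last first.
  by rewrite (leq_trans (size_poly _ _)).
by apply: eq_bigr => i _; rewrite coef_map_id0 ?normr0.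
Qed.

Lemma wnorm_ge0 rho p : 0 <= rho -> 0 <= wnorm rho p.
Proof.
move=> r0; rewrite (wnormE _ (leqnn _)); apply: sumr_ge0 => i _.
by rewrite mulr_ge0 ?exprn_ge0.
Qed.

Lemma wnorm0 rho : wnorm rho 0 = 0.
Proof. by rewrite (@wnormE _ _ 0) ?size_poly0 // big_ord0. Qed.

Lemma wnormD rho p q : 0 <= rho -> wnorm rho (p + q) <= wnorm rho p + wnorm rho q.
Proof.
move=> r0; set n := maxn (size p) (size q).
rewrite (@wnormE _ p n) ?leq_maxl // (@wnormE _ q n) ?leq_maxr //.
rewrite (@wnormE _ (p + q) n) ?size_polyD // -big_split /=.
apply: ler_sum => i _; rewrite -mulrDl coefD ler_wpM2r ?exprn_ge0 //.
exact: ler_normD.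
Qed.

Lemma wnormZ rho c p : wnorm rho (c *: p) = `|c| * wnorm rho p.
Proof.
rewrite (@wnormE _ (c *: p) (size p)) ?size_scale_leq // (wnormE _ (leqnn _)).
by rewrite mulr_sumr; apply: eq_bigr => i _; rewrite coefZ normrM mulrA.
Qed.

Lemma wnorm_sum rho (I : finType) (F : I -> {poly R}) : 0 <= rho ->
  wnorm rho (\sum_i F i) <= \sum_i wnorm rho (F i).
Proof.
move=> r0; elim/big_rec2: _ => [|i y x _ IH]; first by rewrite wnorm0.
by apply: (le_trans (wnormD _ _ r0)); rewrite lerD2l.
Qed.

Lemma wnorm_MXaddC rho p c :
  wnorm rho (p * 'X + c%:P) = wnorm rho p * rho + `|c|.
Proof.
rewrite /wnorm; have -> : map_poly (fun x => `|x|) (p * 'X + c%:P) =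
    map_poly (fun x => `|x|) p * 'X + `|c|%:P.
  apply/polyP => -[|i]; rewrite coef_map_id0 ?normr0 // !coefD !coefMX !coefC /=.
    by rewrite !add0r.
  by rewrite !addr0 coef_map_id0 ?normr0.
by rewrite hornerD hornerM hornerX hornerC.
Qed.

Lemma horner_wnorm rho p x : `|x| <= rho -> `|p.[x]| <= wnorm rho p.
Proof.
move=> xr; rewrite (wnormE _ (leqnn _)) horner_coef.
apply: (le_trans (ler_norm_sum _ _ _)); apply: ler_sum => i _.
rewrite normrM ler_wpM2l // normrX lerXn2r ?nnegrE //.
exact: le_trans xr.
Qed.

(** Horner's scheme: passing from [p] to [p * 'X + c] moves the old remainder [p.[a]] into the
    quotient, and the inequality survives by the triangle inequality. The factor [rho - a] is what
    removing one node gains. *)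
Lemma synthetic_division rho a p : 0 <= a -> a <= rho ->
  exists2 q, p = q * ('X - a%:P) + p.[a]%:P &
             (rho - a) * wnorm rho q + `|p.[a]| <= wnorm rho p.
Proof.
move=> a0 ar; elim/poly_ind: p => [|p c [q Dp Hq]].
  by exists 0; rewrite ?horner0 ?wnorm0 ?mul0r ?add0r // mulr0 normr0 addr0.
exists (q * 'X + p.[a]%:P).
  rewrite {1}Dp !hornerE polyCD polyCM; ring.
rewrite !wnorm_MXaddC !hornerE.
have h := ler_normD (p.[a] * a) c; rewrite normrM (ger0_norm a0) in h.
have r0 := le_trans a0 ar.
have := ler_wpM2r r0 Hq; nra.
Qed.

Lemma nderivn_MXsubC q a c m :
  (q * ('X - a%:P) + c%:P)^`N(m.+1) = q^`N(m) + q^`N(m.+1) * ('X - a%:P).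
Proof.
have -> : q * ('X - a%:P) + c%:P = (q * 'X + c%:P) - a *: q.
  by rewrite -mul_polyC; ring.
rewrite raddfB /= nderivnMXaddC nderivnZ -mul_polyC; ring.
Qed.

(* Dividing out one node at a time keeps the Taylor data at the other nodes
   small because distinct natural numbers are at distance at least 1. *)
Lemma approximate_schwarz (xs : seq nat) (e L rho x : R) (d : nat) p :
  0 <= e -> 1 <= L -> `|x| <= rho ->
  (forall a : nat, a \in xs -> [/\ a%:R < rho, `|x - a%:R| <= L & 4 * `|x - a%:R| <= rho - a%:R]) ->
  (forall a : nat, (count_mem a xs <= d)%N) ->
  (forall (a m : nat), (m < count_mem a xs)%N -> `|p^`N(m).[a%:R]| <= e) ->
  `|p.[x]| <= e * (L * d.+1%:R + 1) ^+ size xs + wnorm rho p / 4 ^+ size xs.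
Proof.
move=> e0 L1 xr; elim: xs e p e0 => [|a xs IH] e p e0 Hn Hd Hp /=.
  rewrite !expr0 divr1 mulr1; have := horner_wnorm p xr; lra.
have [ar xaL xa4] := Hn a (mem_head _ _).
have [q Dp Hq] := synthetic_division p (ler0n _ a) (ltW ar).
have pa : `|p.[a%:R]| <= e.
  by have := Hp a 0%N; rewrite nderivn0 /= eqxx => ->.
have px : p.[x] = q.[x] * (x - a%:R) + p.[a%:R] by rewrite {1}Dp !hornerE.
set B := L * d.+1%:R + 1.
have d0 : 0 <= d%:R :> R by [].
have B1 : L * d.+1%:R + 1 = L * (d%:R + 1) + 1 :> R by rewrite -natr1.
have qe k m : (m < count_mem k xs)%N -> `|q^`N(m).[k%:R]| <= e * (d%:R + 1).
  have [<-|ka] := eqVneq a k => mk.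
    have := Hp a m.+1; rewrite /= eqxx ltnS => /(_ mk).
    rewrite {1}Dp nderivn_MXsubC !hornerE subrr mulr0 addr0 => h.
    by apply: (le_trans h); rewrite ler_peMr // lerDr.
  have k1 : 1 <= `|k%:R - a%:R| :> R.
    have [h|h|h] := ltngtP k a; last by rewrite h eqxx in ka.
    - by rewrite distrC ger0_norm ?subr_ge0 ?ler_nat 1?ltnW // -natrB 1?ltnW // ler1n subn_gt0.
    - by rewrite ger0_norm ?subr_ge0 ?ler_nat 1?ltnW // -natrB 1?ltnW // ler1n subn_gt0.
  have step (y z w : R) : y = z + w * (k%:R - a%:R) -> `|w| <= `|y| + `|z|.
    move=> yz; have : `|w * (k%:R - a%:R)| <= `|y| + `|z|.
      by rewrite (_ : w * _ = y - z) ?ler_normB // yz; ring.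
    rewrite normrM => h; apply: le_trans h; rewrite ler_peMr //.
  have hm j : (j < count_mem k xs)%N -> `|p^`N(j).[k%:R]| <= e.
    by move=> jk; apply: Hp; rewrite /= (negbTE ka).
  (* Taylor coefficients of [q] at [k] are found recursively: the one of order [j+1], times [k - a],
     is that of [p] minus the previous one of [q]. Each order therefore costs one more [e]. *)
  suff qm j : (j < count_mem k xs)%N -> `|q^`N(j).[k%:R]| <= e * j.+2%:R.
    apply: (le_trans (qm _ mk)); rewrite ler_wpM2l // natr1 ler_nat.
    have := Hd k; rewrite /= (negbTE ka) add0n => /(leq_trans mk) h.
    by case: (leqP m.+2 d.+1) => //; rewrite ltnS => h'; rewrite leqNgt ltnS h in h'.
  elim: j => [|j IHj] jk.
    have /step : p.[k%:R] = p.[a%:R] + q.[k%:R] * (k%:R - a%:R).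
      by rewrite {1}Dp !hornerE; ring.
    rewrite nderivn0 /= => h; have := hm 0%N jk; rewrite nderivn0; lra.
  have /step : p^`N(j.+1).[k%:R] = q^`N(j).[k%:R] + q^`N(j.+1).[k%:R] * (k%:R - a%:R).
    by rewrite {1}Dp nderivn_MXsubC !hornerE.
  have := hm _ jk; have := IHj (ltnW jk).
  rewrite -[j.+3%:R]natr1; lra.
have {IH}IH : `|q.[x]| <= e * (d%:R + 1) * B ^+ size xs + wnorm rho q / 4 ^+ size xs.
  apply: IH => //; first by rewrite mulr_ge0 // addr_ge0.
  - by move=> b bx; apply: Hn; rewrite inE bx orbT.
  - by move=> b; apply: leq_trans (Hd b); rewrite leq_addl.
have B_ge1 : 1 <= B ^+ size xs.
  by rewrite exprn_ege1 // /B B1 lerDr mulr_ge0 ?addr_ge0 //; apply: le_trans L1.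
have r0 : 0 <= rho by apply: le_trans xr.
have wq := wnorm_ge0 q r0.
have i4 : 0 < (4 ^+ size xs)^-1 :> R by rewrite invr_gt0 exprn_gt0.
have n0 : 0 <= `|x - a%:R| by [].
have T1 : `|p.[x]| <= e + `|x - a%:R| * `|q.[x]|.
  by rewrite px (le_trans (ler_normD _ _)) // normrM addrC mulrC lerD2r.
have T2 : `|x - a%:R| * `|q.[x]| <= L * (e * (d%:R + 1) * B ^+ size xs)
    + `|x - a%:R| * (wnorm rho q / 4 ^+ size xs).
  apply: (le_trans (ler_wpM2l n0 IH)); rewrite mulrDr lerD2r ler_wpM2r //.
  by rewrite !mulr_ge0 ?addr_ge0 // (le_trans _ B_ge1).
(* The gain of one node: [|x - a|] is at most a quarter of the factor [rho - a] lost by the norm of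
   the quotient. *)
have T3 : `|x - a%:R| * (wnorm rho q / 4 ^+ size xs) <= wnorm rho p / 4 ^+ (size xs).+1.
  rewrite exprS invfM [wnorm rho p * _]mulrA mulrA ler_wpM2r ?(ltW i4) //.
  have pa0 := normr_ge0 p.[a%:R]; have := ler_wpM2r wq xa4. lra.
have T4 : e + L * (e * (d%:R + 1) * B ^+ size xs) <= e * B ^+ (size xs).+1.
  rewrite exprS.
  have -> : e * (B * B ^+ size xs) = L * (e * (d%:R + 1) * B ^+ size xs) + e * B ^+ size xs.
    by rewrite /B B1; ring.
  by rewrite addrC lerD2l ler_peMr.
lra.
Qed.
End WeightedNorm.

(** * Siegel's lemma *)

Lemma card_pigeonhole (A B : finType) (f : A -> B) : (#|B| < #|A|)%N ->
  exists x y, x != y /\ f x = f y.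
Proof.
move=> h; have /injectivePn[x [y xy fxy]] : ~~ injectiveb f.
  by apply/negP => /injectiveP /leq_card; rewrite leqNgt h.
by exists x, y.
Qed.

(** Pigeonhole on vectors with entries in [[0, P]]; the difference of two vectors with the same
    image is the solution. Images are shifted by [u * P * B] to become natural numbers. *)
Lemma siegel_lemma (I E : finType) (a : E -> I -> int) (B : nat) :
  (0 < B)%N -> (0 < #|I|)%N -> (2 * #|E| <= #|I|)%N ->
  (forall e i, `|a e i| <= B%:Z) ->
  exists p : I -> int, [/\ exists i, p i != 0,
    forall i, `|p i| <= (2 * #|I| * B)%:Z & forall e, \sum_i p i * a e i = 0].
Proof.
move=> B0 I0 EI aB; set u := #|I| in I0 EI *; set P := (2 * u * B)%N.
pose g (x : {ffun I -> 'I_P.+1}) e : int := \sum_i (x i)%:Z * a e i.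
have gB x e : `|g x e| <= (u * (P * B))%:Z.
  apply: (le_trans (ler_norm_sum _ _ _)).
  have -> : (u * (P * B))%:Z = \sum_(i in I) (P * B)%:Z.
    by rewrite sumr_const -/u PoszM -mulr_natl natz.
  apply: ler_sum => i _; rewrite normrM PoszM ler_pM //.
  by have := ltn_ord (x i); lia.
pose f (x : {ffun I -> 'I_P.+1}) : {ffun E -> 'I_(2 * (u * (P * B))).+1} :=
  [ffun e => inord (absz (g x e + (u * (P * B))%:Z))].
have [|x [y [xy fxy]]] := @card_pigeonhole _ _ f.
  rewrite !card_ffun !card_ord -/u.
  (* Since [P = 2 u B], the number of values of one equation is [P^2 + 1], less than [(P+1)^2]; this
     is why twice as many unknowns as equations suffice. *)
  have h : ((2 * (u * (P * B))).+1 < P.+1 ^ 2)%N by rewrite expnS expn1 /P; nia.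
  have [E0|E0] := posnP #|E|.
    by rewrite E0 expn0 -[X in (X < _)%N](exp1n u) ltn_exp2r // ltnS /P !muln_gt0 I0 B0.
  apply: (@leq_trans ((P.+1 ^ 2) ^ #|E|)); first by rewrite ltn_exp2r.
  by rewrite -expnM leq_pexp2l.
exists (fun i => (x i)%:Z - (y i)%:Z); split.
- have /existsP[i xi] : [exists i, x i != y i].
    apply/contraT; rewrite negb_exists => /forallP h; case/eqP: xy.
    by apply/ffunP => i; apply/eqP; rewrite -[_ == _]negbK.
  exists i; rewrite subr_eq0; apply: contra xi; rewrite eqz_nat => /eqP h.
  exact/eqP/val_inj.
- by move=> i; have := ltn_ord (x i); have := ltn_ord (y i); rewrite -/P; lia.
- move=> e; under eq_bigr do rewrite mulrBl; rewrite sumrB.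
  have /ffunP/(_ e)/(congr1 val) := fxy; rewrite !ffunE /= !inordK.
  + by have := gB x e; have := gB y e; rewrite -/(g x e) -/(g y e); lia.
  + by have := gB y e; lia.
  + by have := gB x e; lia.
Qed.

(** * The norm of the cubic field *)

(* The norm of [a + b x + c x^2] from the cubic field of [x^3 = x + 1]. *)
Definition cubic_norm (a b c : int) : int :=
  a ^+ 3 + b ^+ 3 + c ^+ 3 - a * b ^+ 2 - b * c ^+ 2 + 2 * a ^+ 2 * c + a * c ^+ 2 - 3 * a * b * c.

(** The product of the other two conjugates of [a + b x + c x^2], rewritten in the basis
    [1, x, x^2], so that it is available without the complex roots. *)
Definition cubic_conorm (R : comRingType) (x a b c : R) : R :=
  (a ^+ 2 - b ^+ 2 + c ^+ 2 + 2 * a * c - b * c) 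
  + (c ^+ 2 - a * b) * x + (b ^+ 2 - a * c - c ^+ 2) * x ^+ 2.

Lemma cubic_normE (R : comRingType) (x : R) (a b c : int) : x ^+ 3 = x + 1 ->
  (cubic_norm a b c)%:~R = (a%:~R + b%:~R * x + c%:~R * x ^+ 2) * cubic_conorm x a%:~R b%:~R c%:~R :> R.
Proof.
move=> h; have h4 : x ^+ 4 = x ^+ 2 + x by rewrite exprS h; ring.
rewrite /cubic_norm /cubic_conorm.
set A : R := a%:~R; set B : R := b%:~R; set C : R := c%:~R.
have -> : (a ^+ 3 + b ^+ 3 + c ^+ 3 - a * b ^+ 2 - b * c ^+ 2 + 2 * a ^+ 2 * c + a * c ^+ 2
    - 3 * a * b * c)%:~R =
  A ^+ 3 + B ^+ 3 + C ^+ 3 - A * B ^+ 2 - B * C ^+ 2 + 2 * A ^+ 2 * C + A * C ^+ 2 - 3 * A * B * C :> R.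
  by rewrite /A /B /C; ring.
ring: h h4.
Qed.

(* The norm form is anisotropic over the field with two elements, since
   [x^3 + x + 1] is irreducible there; descent then gives anisotropy over [Z]. *)
Lemma cubic_norm_even (a b c : int) : cubic_norm a b c = 0 ->
  exists a' b' c' : int, [/\ a = 2 * a', b = 2 * b' & c = 2 * c'].
Proof.
have ex (x : int) : exists y (e : int), x = 2 * y + e /\ (e = 0 \/ e = 1).
  by exists (x %/ 2)%Z, (x %% 2)%Z; split; lia.
have [a' [i [-> hi]]] := ex a; have [b' [j [-> hj]]] := ex b; have [c' [k [-> hk]]] := ex c.
rewrite /cubic_norm !exprS !expr0 => h.
exists a', b', c'.
by case: hi hj hk => -> [->|->] [->|->] in h *; split; lia.
Qed.

Lemma cubic_norm_eq0 (a b c : int) : cubic_norm a b c = 0 -> [/\ a = 0, b = 0 & c = 0].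
Proof.
have [n] := ubnP (absz a + absz b + absz c)%N.
elim: n a b c => // n IH a b c hn h0.
have [a' [b' [c' [ha hb hc]]]] := cubic_norm_even h0.
have h0' : cubic_norm a' b' c' = 0.
  move: h0; rewrite ha hb hc /cubic_norm => h.
  have : 8 * cubic_norm a' b' c' = 0 by rewrite -[RHS]h /cubic_norm; ring.
  by move/eqP; rewrite mulf_eq0 /= => /eqP.
have [z|nz] := eqVneq (absz a + absz b + absz c)%N 0%N.
  by split; lia.
have [|a0 b0 c0] := IH a' b' c' _ h0'; first by lia.
by rewrite ha hb hc a0 b0 c0.
Qed.

Fixpoint cubic_pow (e : nat) : nat * nat * nat :=
  if e is e'.+1 then let: (u, v, w) := cubic_pow e' in (w, u + w, v)%N else (1, 0, 0)%N.

Lemma cubic_powE (R : comRingType) (x : R) e : x ^+ 3 = x + 1 ->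
  let: (u, v, w) := cubic_pow e in x ^+ e = u%:R + v%:R * x + w%:R * x ^+ 2.
Proof.
move=> h; elim: e => [|e] /=; first by rewrite expr0; ring.
case: (cubic_pow e) => [[u v] w] IH; rewrite exprS IH natrD.
have -> : x * (u%:R + v%:R * x + w%:R * x ^+ 2) = u%:R * x + v%:R * x ^+ 2 + w%:R * x ^+ 3 by ring.
by rewrite h; ring.
Qed.

Section Liouville.
Variables (R : realFieldType) (x : R).
Hypotheses (x3 : x ^+ 3 = x + 1) (x1 : 1 <= x) (x2 : x <= 2).

(** The coordinates of [x^e] are natural numbers, so the terms of [u + v x + w x^2] cannot cancel
    and each coordinate is at most the sum. *)
Lemma cubic_pow_le e :
  let: (u, v, w) := cubic_pow e in
  [/\ u%:R <= x ^+ e, v%:R <= x ^+ e & w%:R <= x ^+ e].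
Proof.
have := cubic_powE e x3; case: (cubic_pow e) => [[u v] w] ->.
have xx : 1 <= x ^+ 2 by rewrite exprn_ege1.
have := ler0n R u; have := ler0n R v; have := ler0n R w; move=> w0 v0 u0.
have v1 : v%:R <= v%:R * x by rewrite ler_peMr.
have w1 : w%:R <= w%:R * x ^+ 2 by rewrite ler_peMr.
split; lra.
Qed.

(** The norm of a nonzero [S] is a nonzero integer, and its cofactor is at most
    [(6 + 4 + 12) H^2 = 22 H^2], rounded up to a power of two. Height is measured by [H], which
    bounds all three coordinates. *)
Lemma cubic_liouville (I : finType) (c : I -> int) (e : I -> nat) :
  let S := \sum_i (c i)%:~R * x ^+ e i in
  S != 0 -> 1 <= `|S| * (32 * (\sum_i `|(c i)%:~R| * x ^+ e i) ^+ 2).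
Proof.
move=> S S0; set H := \sum_i _.
pose co (pr : nat * nat * nat -> nat) : int := \sum_i c i * (pr (cubic_pow (e i)))%:Z.
have coH pr : (forall i, (pr (cubic_pow i))%:R <= x ^+ i) -> `|(co pr)%:~R| <= H.
  move=> hpr; rewrite /co raddf_sum /= (le_trans (ler_norm_sum _ _ _)) //.
  apply: ler_sum => i _; rewrite intrM normrM ler_wpM2l //.
  by rewrite -pmulrn ger0_norm.
set a := co (fun p => p.1.1); set b := co (fun p => p.1.2); set d := co (fun p => p.2).
have aH : `|a%:~R| <= H.
  by apply: coH => i; have := cubic_pow_le i; case: (cubic_pow i) => [[u v] w] [].
have bH : `|b%:~R| <= H.
  by apply: coH => i; have := cubic_pow_le i; case: (cubic_pow i) => [[u v] w] [].
have dH : `|d%:~R| <= H.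
  by apply: coH => i; have := cubic_pow_le i; case: (cubic_pow i) => [[u v] w] [].
have SE : S = a%:~R + b%:~R * x + d%:~R * x ^+ 2.
  rewrite /a /b /d /co !raddf_sum /= !mulr_suml -!big_split /=.
  apply: eq_bigr => i _; have := cubic_powE (e i) x3.
  by case: (cubic_pow (e i)) => [[u v] w] ->; rewrite !intrM -!pmulrn; ring.
have Nn0 : cubic_norm a b d != 0.
  apply: contra S0 => /eqP/cubic_norm_eq0[a0 b0 d0].
  by rewrite SE a0 b0 d0; apply/eqP; ring.
have N1 : 1 <= `|(cubic_norm a b d)%:~R| :> R.
  by rewrite -intr_norm -[1]/(1%:~R) ler_int; lia.
apply: (le_trans N1); rewrite (cubic_normE _ _ _ x3) -SE normrM ler_wpM2l //.
rewrite /cubic_conorm; move: aH bH dH.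
move: (a%:~R : R) (b%:~R : R) (d%:~R : R) => {S0 SE N1 Nn0 S} A B D aH bH dH.
have H0 : 0 <= H by apply: le_trans aH.
have M (y z : R) : `|y| <= H -> `|z| <= H -> - H ^+ 2 <= y * z <= H ^+ 2.
  by move=> hy hz; rewrite -ler_norml normrM expr2 ler_pM.
have Mx (y : R) k : - k * H ^+ 2 <= y <= k * H ^+ 2 -> 0 <= k -> 
   - (2 * k) * H ^+ 2 <= y * x <= 2 * k * H ^+ 2.
  move=> /andP[h1 h2] k0; have kh : 0 <= k * H ^+ 2 by rewrite mulr_ge0 ?sqr_ge0.
  have x0 : 0 <= x by apply: le_trans x1.
  have := ler_wpM2r x0 h1; have := ler_wpM2r x0 h2; have := ler_wpM2l kh x2.
  by move=> *; apply/andP; split; lra.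
have Mxx (y : R) k : - k * H ^+ 2 <= y <= k * H ^+ 2 -> 0 <= k -> 
   - (4 * k) * H ^+ 2 <= y * x ^+ 2 <= 4 * k * H ^+ 2.
  move=> h k0; have := Mx _ _ (Mx _ _ h k0) (mulr_ge0 (ler0n _ 2) k0).
  by rewrite expr2 mulrA; lra.
have AA := M _ _ aH aH; have BB := M _ _ bH bH; have DD := M _ _ dH dH.
have AB := M _ _ aH bH; have AD := M _ _ aH dH; have BD := M _ _ bH dH.
have t1 : - 2 * H ^+ 2 <= D ^+ 2 - A * B <= 2 * H ^+ 2 by rewrite expr2; lra.
have t2 : - 3 * H ^+ 2 <= B ^+ 2 - A * D - D ^+ 2 <= 3 * H ^+ 2.
  by rewrite ![_ ^+ 2 in X in _ <= X <= _]expr2; lra.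
have := Mx _ _ t1 (ler0n _ 2); have := Mxx _ _ t2 (ler0n _ 3).
rewrite ler_norml -[A ^+ 2]/(A * A) -[B ^+ 2]/(B * B) -[D ^+ 2]/(D * D).
have := sqr_ge0 H; lra.
Qed.
End Liouville.

(** * Extrapolation *)

Section TruncatedExponential.
Variable R : realType.
Implicit Types (x y : R).

Definition truncated_exp n y : R := \sum_(m < n) y ^+ m / m`!%:R.

Lemma truncated_expE n y : truncated_exp n y = series (exp_coeff y) n.
Proof. by rewrite /truncated_exp /series /= big_mkord. Qed.

Lemma truncated_exp_cvg y e : 0 < e ->
  exists n0, forall n, (n0 <= n)%N -> `|truncated_exp n y - expR y| <= e.
Proof.
move=> e0; have /cvgrPdist_le/(_ e e0)[n0 _ h] := is_cvg_series_exp_coeff y.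
by exists n0 => n /h; rewrite distrC truncated_expE.
Qed.

Lemma truncated_exp_cvg_fin (T : finType) (y : T -> R) e : 0 < e ->
  exists n0, forall n t, (n0 <= n)%N -> `|truncated_exp n (y t) - expR (y t)| <= e.
Proof.
move=> e0; have [f hf] := fin_all_exists (fun t => truncated_exp_cvg (y t) e0).
exists (\max_t f t)%N => n t hn; apply: hf; apply: leq_trans hn.
exact: leq_bigmax.
Qed.

Lemma truncated_exp_le n y : 0 <= y -> truncated_exp n y <= expR y.
Proof.
move=> y0; rewrite truncated_expE; apply: nondecreasing_cvgn_le.
  apply/nondecreasing_seqP => k; rewrite -!truncated_expE /truncated_exp big_ord_recr lerDl /= mulr_ge0 ?exprn_ge0 ?invr_ge0 // ler0n.
exact: is_cvg_series_exp_coeff.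
Qed.

Definition truncated_exp_poly n y : {poly R} := \poly_(m < n) (y ^+ m / m`!%:R).

Lemma horner_truncated_exp n y x : (truncated_exp_poly n y).[x] = truncated_exp n (x * y).
Proof.
rewrite horner_poly; apply: eq_bigr => m _.
by rewrite exprMn; ring.
Qed.

(** The divided derivatives stay in the same family and only lose [m] terms, so a length exceeding
    the convergence threshold by [d] controls all orders up to [d]. *)
Lemma nderivn_truncated_exp n y m : (m <= n)%N ->
  (truncated_exp_poly n y)^`N(m) = (y ^+ m / m`!%:R) *: truncated_exp_poly (n - m) y.
Proof.
move=> mn; apply/polyP => i; rewrite coef_nderivn coefZ !coef_poly.
rewrite -ltn_subRL; case: ifP => _; last by rewrite mul0rn mulr0.
have f0 k : k`!%:R != 0 :> R by rewrite pnatr_eq0 -lt0n fact_gt0.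
have := bin_fact (leq_addr i m); rewrite addKn => /(congr1 (fun k => k%:R : R)).
rewrite !natrM -mulr_natr exprD => h; rewrite -h.
by field; rewrite !f0 pnatr_eq0 -lt0n bin_gt0 leq_addr.
Qed.

Lemma wnorm_truncated_exp rho n y : 0 <= rho ->
  wnorm rho (truncated_exp_poly n y) <= expR (`|y| * rho).
Proof.
move=> r0; apply: (@le_trans _ _ (truncated_exp n (`|y| * rho))).
  rewrite (@wnormE _ _ _ n) ?size_poly //; apply: ler_sum => m _.
  by rewrite coef_poly ltn_ord normrM normrX normfV normr_nat exprMn mulrAC.
by apply: truncated_exp_le; rewrite mulr_ge0.
Qed.

End TruncatedExponential.

Section Extrapolation.
Variables (R : realType) (x : R).
Hypotheses (x3 : x ^+ 3 = x + 1) (x1 : 1 <= x) (x2 : x <= 2).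
Variables (I : finType) (X Y p g : I -> int) (r : I -> nat) (c0 c1 c2 : R).

Definition eval_point q : R := (g q)%:~R * x ^+ r q.
Definition log_form q : R := c0 + c1 * (X q)%:~R + c2 * (Y q)%:~R.
Definition coefXY i j q : int := p q * X q ^+ i * Y q ^+ j.
Definition moment i j k : R := \sum_q (coefXY i j q)%:~R * eval_point q ^+ k.
Definition vanishing D K := forall i j k, (i + j < D)%N -> (k < K)%N -> moment i j k = 0.

(** Each factor [c0 + c1 X + c2 Y] raises the total degree in [X], [Y] by at most one, so [m]
    derivatives are paid for by [m] units of [D]. *)
Lemma moment_log_form D K m i j k : vanishing D K -> (i + j + m < D)%N -> (k < K)%N ->
  \sum_q (coefXY i j q)%:~R * (log_form q ^+ m * eval_point q ^+ k) = 0.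
Proof.
move=> hV; elim: m i j => [|m IH] i j hD kK.
  under eq_bigr do rewrite expr0 mul1r.
  by apply: hV => //; rewrite addn0 in hD.
rewrite (eq_bigr (fun q => c0 * ((coefXY i j q)%:~R * (log_form q ^+ m * eval_point q ^+ k))
  + c1 * ((coefXY i.+1 j q)%:~R * (log_form q ^+ m * eval_point q ^+ k))
  + c2 * ((coefXY i j.+1 q)%:~R * (log_form q ^+ m * eval_point q ^+ k)))).
  by rewrite !big_split /= -!mulr_sumr !IH ?mulr0 ?addr0 //; lia.
move=> q _; rewrite exprS {1}/log_form /coefXY !exprS !intrM; ring.
Qed.

Variables (D0 H beta Kmax : nat) (delta : R).
Hypothesis coef_le : forall i j, (i + j <= D0)%N -> \sum_q `|(coefXY i j q)%:~R| <= 2 ^+ beta :> R.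
Hypothesis g_ge0 : forall q, 0 <= g q.
Hypothesis W_le : forall q, eval_point q <= 2 ^+ H.
Hypothesis theta_le : forall q, `|log_form q| <= H%:R.
Hypothesis exp_theta_le : forall q, expR `|log_form q| <= 2 ^+ H.
Hypothesis delta_gt0 : 0 < delta.
Hypothesis exp_close : forall q k, (k <= Kmax)%N ->
  `|expR (k%:R * log_form q) - eval_point q ^+ k| <= delta.

Lemma eval_point_ge0 q : 0 <= eval_point q.
Proof. by rewrite mulr_ge0 ?ler0z ?exprn_ge0 // (le_trans ler01). Qed.

Lemma moment_liouville i j k : (i + j <= D0)%N -> moment i j k != 0 ->
  1 <= `|moment i j k| * 2 ^+ (5 + 2 * beta + 2 * (H * k)).
Proof.
move=> ij M0.
pose c q := coefXY i j q * g q ^+ k; pose e q := (r q * k)%N.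
have E q : (coefXY i j q)%:~R * eval_point q ^+ k = (c q)%:~R * x ^+ e q.
  by rewrite /c /e /eval_point exprMn -exprM intrM rmorphXn /= mulrA.
have ME : moment i j k = \sum_q (c q)%:~R * x ^+ e q.
  by apply: eq_bigr => q _.
have := cubic_liouville x3 x1 x2 (c := c) (e := e); rewrite -ME => /(_ M0) L.
apply: (le_trans L); rewrite ler_wpM2l // 2!exprD (_ : 2 ^+ 5 = 32); last by ring.
rewrite -mulrA ler_wpM2l // ![(2 * _)%N]mulnC !exprM -exprMn lerXn2r ?nnegrE //.
- by apply: sumr_ge0 => q _; rewrite mulr_ge0 ?exprn_ge0 // (le_trans ler01).
- by rewrite mulr_ge0 ?exprn_ge0.
apply: (@le_trans _ _ (\sum_q `|(coefXY i j q)%:~R| * 2 ^+ H ^+ k)); last first.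
  by rewrite -mulr_suml ler_wpM2r ?exprn_ge0 ?coef_le.
apply: ler_sum => q _; rewrite -[x ^+ e q]ger0_norm ?exprn_ge0 ?(le_trans ler01) //.
rewrite -normrM -E normrM ler_wpM2l // ger0_norm ?exprn_ge0 ?eval_point_ge0 //.
by rewrite lerXn2r ?nnegrE ?eval_point_ge0 ?exprn_ge0.
Qed.

Definition nodes d K : seq nat := flatten (nseq d (iota 0 K)).

Lemma size_nodes d K : size (nodes d K) = (d * K)%N.
Proof. by elim: d => //= d IH; rewrite size_cat IH size_iota. Qed.

Lemma count_nodes d K a : count_mem a (nodes d K) = (d * (a < K))%N.
Proof.
by elim: d => //= d IH; rewrite count_cat IH count_uniq_mem ?iota_uniq // mem_iota.
Qed.

Lemma mem_nodes d K a : a \in nodes d K -> (a < K)%N.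
Proof.
rewrite -has_pred1 has_count count_nodes.
by case: (a < K)%N; rewrite ?muln0.
Qed.

Section Step.
Variables (d Q K D b Z : nat).
Hypotheses (D_le : (D + d <= D0)%N) (K_gt0 : (0 < K)%N) (Q_gt0 : (0 < Q)%N).
Hypothesis QK_le : (Q * K <= Kmax)%N.
Hypothesis gain : (3 * beta + 7 * H * (Q * K) + 7 <= 2 * (d * K))%N.
Hypotheses (H_le : (H <= 2 ^ b)%N) (Kmax_le : (Kmax * d.+1 + 1 <= 2 ^ b)%N).
Hypothesis Z_ge : (3 * beta + 2 * (H * Kmax) + 10 + b * d * (Kmax + 1) <= Z)%N.
Hypothesis delta_le : delta * 2 ^+ Z <= 1.
Hypothesis V : vanishing (D + d) K.

(** The Schwarz lemma is applied to [G(z)], the sum of [p X^i Y^j exp(z log_form)] with truncated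
    exponentials. At each node below [K], its derivatives up to order [d] are close to sums that
    vanish by [moment_log_form]. For points and nodes below [Q K], the radius [5 Q K] leaves a
    distance of at least [4 Q K], hence the gain of 4 per node. *)
Lemma moment_small i j k : (i + j < D)%N -> (k < Q * K)%N ->
  `|moment i j k| <= 2 ^+ beta.+1 * delta * (1 + 2 ^+ (b * d * (Kmax + 1)))
                   + 2 ^+ (beta + 5 * H * (Q * K)) / 4 ^+ (d * K).
Proof.
move=> ij kQ.
have C := coef_le (leq_trans (ltnW ij) (leq_trans (leq_addr d D) D_le)).
pose T : finType := (I * 'I_Kmax.+1 : finType)%type.
have [n0 hn0] := truncated_exp_cvg_fin (fun t : T => (nat_of_ord t.2)%:R * log_form t.1) delta_gt0.
pose n := (n0 + d)%N.
have texp_close q m a : (m <= d)%N -> (a <= Kmax)%N ->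
    `|truncated_exp (n - m) (a%:R * log_form q) - eval_point q ^+ a| <= 2 * delta.
  move=> md aK; have := hn0 (n - m)%N (q, Ordinal (aK : (a < Kmax.+1)%N)); rewrite /=.
  have -> : (n0 <= n - m)%N by rewrite /n; lia.
  move=> /(_ isT); have := exp_close q aK; rewrite !ler_norml; lra.
pose G : {poly R} := \sum_q (coefXY i j q)%:~R *: truncated_exp_poly n (log_form q).
have Gk : `|moment i j k - G.[k%:R]| <= 2 ^+ beta.+1 * delta.
  rewrite /moment horner_sum -sumrB exprS mulrAC (le_trans (ler_norm_sum _ _ _)) //.
  apply: (@le_trans _ _ (\sum_q `|(coefXY i j q)%:~R| * (2 * delta))); last first.
    by rewrite -mulr_suml mulrC; rewrite ler_wpM2l // mulr_ge0 // ltW.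
  apply: ler_sum => q _; rewrite hornerZ horner_truncated_exp -mulrBr normrM.
  rewrite ler_wpM2l // distrC -[n]subn0; apply: texp_close => //; lia.
have r0 : 0 <= (5 * (Q * K))%:R :> R by [].
have Gnorm : wnorm (5 * (Q * K))%:R G <= 2 ^+ (beta + 5 * H * (Q * K)).
  rewrite (le_trans (wnorm_sum _ r0)) //.
  apply: (@le_trans _ _ (\sum_q `|(coefXY i j q)%:~R| * 2 ^+ (5 * H * (Q * K)))); last first.
    by rewrite -mulr_suml exprD ler_wpM2r ?exprn_ge0.
  apply: ler_sum => q _; rewrite wnormZ ler_wpM2l //.
  rewrite (le_trans (wnorm_truncated_exp _ _ r0)) // expRM_natr.
  have -> : (5 * H * (Q * K) = H * (5 * (Q * K)))%N by lia.
  by rewrite [X in _ <= X]exprM lerXn2r ?nnegrE ?expR_ge0 ?exprn_ge0.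
pose e : R := 2 ^+ beta.+1 * delta * (2 ^+ b) ^+ d.
have b1 : 1 <= 2 ^+ b :> R by rewrite exprn_ege1 // ler1n.
have Gdata a m : (m < count_mem a (nodes d K))%N -> `|G^`N(m).[a%:R]| <= e.
  rewrite count_nodes; case: (ltnP a K) => aK; rewrite ?muln0 ?muln1 // => md.
  have aKm : (a <= Kmax)%N by rewrite (leq_trans _ QK_le) // (leq_trans (ltnW aK)) // leq_pmull.
  have -> : G^`N(m).[a%:R] = \sum_q (coefXY i j q)%:~R * (log_form q ^+ m / m`!%:R *
      (truncated_exp (n - m) (a%:R * log_form q) - eval_point q ^+ a)).
    transitivity (\sum_q ((coefXY i j q)%:~R * (log_form q ^+ m / m`!%:R *
      truncated_exp (n - m) (a%:R * log_form q)) - m`!%:R^-1 *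
      ((coefXY i j q)%:~R * (log_form q ^+ m * eval_point q ^+ a)))); last first.
      by apply: eq_bigr => q _; ring.
    rewrite sumrB -mulr_sumr (moment_log_form V) ?mulr0 ?subr0 //; last by lia.
    rewrite /G raddf_sum /= horner_sum; apply: eq_bigr => q _.
    rewrite nderivnZ nderivn_truncated_exp; last by rewrite /n; lia.
    by rewrite !hornerZ horner_truncated_exp.
  rewrite (le_trans (ler_norm_sum _ _ _)) //.
  apply: (@le_trans _ _ (\sum_q `|(coefXY i j q)%:~R| * ((2 ^+ b) ^+ d * (2 * delta)))); last first.
    have -> : e = 2 ^+ beta * ((2 ^+ b) ^+ d * (2 * delta)) by rewrite /e exprS; ring.
    by rewrite -mulr_suml ler_wpM2r // !mulr_ge0 ?exprn_ge0 // ltW.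
  apply: ler_sum => q _; rewrite normrM ler_wpM2l // normrM ler_pM //; last first.
    by apply: texp_close => //; apply: ltnW.
  rewrite normrM normrX normfV normr_nat.
  apply: (@le_trans _ _ (`|log_form q| ^+ m)).
    by rewrite ler_piMr ?exprn_ge0 // invf_le1 ?ler1n ?ltr0n fact_gt0.
  apply: (@le_trans _ _ ((2 ^+ b) ^+ m)); last by rewrite ler_weXn2l // ltnW.
  rewrite lerXn2r ?nnegrE ?exprn_ge0 // (le_trans (theta_le q)) //.
  by rewrite -natrX ler_nat.
have KQ : (K <= Q * K)%N by rewrite leq_pmull.
have kr : `|k%:R| <= (5 * (Q * K))%:R :> R.
  by rewrite normr_nat ler_nat (leq_trans (ltnW kQ)) // leq_pmull.
have e0 : 0 <= e by rewrite /e !mulr_ge0 ?exprn_ge0 // ltW.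
have QK1 : 1 <= (Q * K)%:R :> R by rewrite ler1n muln_gt0 Q_gt0.
have hn (a : nat) : a \in nodes d K -> [/\ a%:R < (5 * (Q * K))%:R :> R, `|k%:R - a%:R| <= (Q * K)%:R :> R
    & 4 * `|k%:R - a%:R| <= (5 * (Q * K))%:R - a%:R :> R].
  move=> /mem_nodes aK; have aQK : (a < Q * K)%N by apply: leq_trans KQ.
  have h : `|k%:R - a%:R| <= (Q * K)%:R :> R.
    have : k%:R <= (Q * K)%:R :> R by rewrite ler_nat ltnW.
    have : a%:R <= (Q * K)%:R :> R by rewrite ler_nat ltnW.
    by rewrite ler_norml; have := ler0n R k; have := ler0n R a; lra.
  split=> //; first by rewrite ltr_nat (leq_trans aQK) // leq_pmull.
  rewrite [(5 * _)%:R]natrM; have : a%:R <= (Q * K)%:R :> R by rewrite ler_nat ltnW.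
  lra.
have hd (a : nat) : (count_mem a (nodes d K) <= d)%N.
  by rewrite count_nodes; case: (_ < _)%N; rewrite ?muln1 ?muln0.
have := @approximate_schwarz R (nodes d K) e (Q * K)%:R (5 * (Q * K))%:R k%:R d G e0 QK1 kr hn hd Gdata; rewrite size_nodes => S.
have S1 : e * ((Q * K)%:R * d.+1%:R + 1) ^+ (d * K) <= 2 ^+ beta.+1 * delta * 2 ^+ (b * d * (Kmax + 1)).
  rewrite /e -!mulrA !ler_wpM2l ?exprn_ge0 //; first exact: ltW.
  rewrite -exprM.
  apply: (@le_trans _ _ (2 ^+ (b * d) * 2 ^+ (b * (d * K)))).
    rewrite ler_wpM2l ?exprn_ge0 // [X in _ <= X]exprM lerXn2r ?nnegrE ?exprn_ge0 //.
      by rewrite addr_ge0 // mulr_ge0.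
    rewrite -natrM natr1 -natrX ler_nat -addn1; apply: leq_trans Kmax_le.
    by rewrite leq_add2r leq_mul2r QK_le orbT.
  rewrite -exprD ler_weXn2l ?ler1n // mulnA -[X in (X + _)%N]muln1 -mulnDr leq_mul2l.
  by rewrite addnC leq_add2r (leq_trans _ QK_le) ?orbT // leq_pmull.
have S2 : wnorm (5 * (Q * K))%:R G / 4 ^+ (d * K) <= 2 ^+ (beta + 5 * H * (Q * K)) / 4 ^+ (d * K).
  by rewrite ler_wpM2r // invr_ge0 exprn_ge0.
have -> : moment i j k = (moment i j k - G.[k%:R]) + G.[k%:R] by rewrite subrK.
by rewrite (le_trans (ler_normD _ _)) // mulrDr mulr1; lra.
Qed.

(** A nonzero moment is at least [2^-(5 + 2 beta + 2 H k)] by the norm. The main term of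
    [moment_small] is smaller when [3 beta + 7 H Q K + 7 <= 2 d K], where [7 = 5 + 2] collects the
    growth on the circle of radius [5 Q K] and the height; [Z] absorbs the term with [delta]. *)
Lemma vanishing_step : vanishing D (Q * K).
Proof.
move=> i j k ij kQ; apply/eqP/contraT => M0.
have ijD : (i + j <= D0)%N by lia.
have := moment_liouville ijD M0; have := moment_small ij kQ.
set m := `|_|; set z := (5 + 2 * beta + 2 * (H * k))%N => m1 m2.
have z0 : 0 <= 2 ^+ z :> R by rewrite exprn_ge0.
have main : 2 ^+ (beta + 5 * H * (Q * K)) / 4 ^+ (d * K) * 2 ^+ z <= 1 / 4 :> R.
  rewrite mulrAC ler_pdivrMr ?exprn_gt0 // mulrAC ler_pdivlMr // mul1r.
  have -> : 4 = 2 ^+ 2 :> R by ring.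
  by rewrite -!exprM -!exprD ler_weXn2l ?ler1n // /z; nia.
have tiny : 2 ^+ beta.+1 * delta * (1 + 2 ^+ (b * d * (Kmax + 1))) * 2 ^+ z <= 1 / 2.
  have -> : 2 ^+ beta.+1 * delta * (1 + 2 ^+ (b * d * (Kmax + 1))) * 2 ^+ z =
    delta * (2 ^+ (beta.+1 + z) * (1 + 2 ^+ (b * d * (Kmax + 1)))) by rewrite exprD; ring.
  rewrite ler_pdivlMr // -mulrA; apply: le_trans delta_le.
  rewrite ler_wpM2l ?(ltW delta_gt0) //.
  apply: (@le_trans _ _ (2 ^+ (beta.+1 + z) * 2 ^+ (b * d * (Kmax + 1)).+1 * 2)).
    rewrite !ler_wpM2r // ler_wpM2l ?exprn_ge0 // [X in _ <= X]exprS.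
    have h : 1 <= 2 ^+ (b * d * (Kmax + 1)) :> R by rewrite exprn_ege1 ?ler1n.
    by rewrite mulr2n mulrDl mul1r lerD2r.
  rewrite -exprD -exprSr ler_weXn2l ?ler1n // /z; nia.
have := ler_wpM2r z0 m1; rewrite mulrDl; lra.
Qed.
End Step.
End Extrapolation.

(** * Baker's argument *)

(** Pairing the relations with the coefficients of the polynomial that vanishes at every [w q]
    except [w q0] isolates [p q0]. *)
Lemma vandermonde_eq0 (F : fieldType) (I : finType) (w p : I -> F) : injective w ->
  (forall k, (k < #|I|)%N -> \sum_q p q * w q ^+ k = 0) -> forall q, p q = 0.
Proof.
move=> wI h q0; pose P := \prod_(q | q != q0) ('X - (w q)%:P).
have sP : size P = #|I|.
  rewrite /P -big_enum size_prod_XsubC -cardE.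
  have := cardC1 q0; rewrite (eq_card (B := predC1 q0)) // => ->.
  by rewrite prednK //; apply/card_gt0P; exists q0.
have : \sum_q p q * P.[w q] = 0.
  under eq_bigr do rewrite horner_coef mulr_sumr.
  rewrite exchange_big /= big1 // => k _.
  under eq_bigr do rewrite mulrCA.
  by rewrite -mulr_sumr h ?mulr0 // -sP.
rewrite (bigD1 q0) //= big1 ?addr0 => [|q qq0].
  move/eqP; rewrite mulf_eq0 => /orP[/eqP//|].
  rewrite horner_prod prodf_seq_eq0 => /hasP[q _ /andP[qq0]].
  rewrite !hornerE subr_eq0 => /eqP/wI e; by rewrite e eqxx in qq0.
by rewrite horner_prod (bigD1 q) //= hornerXsubC subrr mul0r mulr0.
Qed.

Section Irrationality.
Variables (R : realFieldType) (x : R).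
Hypotheses (x3 : x ^+ 3 = x + 1) (x1 : 1 <= x) (x2 : x <= 2).

(** For [m > 0] the coordinates of [x^m] on [x] and [x^2] are not both zero, so a rational value
    would give a nontrivial zero of the norm form. *)
Lemma cubic_pow_rational m a b : (0 < b)%N -> x ^+ m * b%:R = a%:R -> m = 0%N.
Proof.
move=> b0; case: m => // m; have := cubic_powE m.+1 x3.
have : (0 < (cubic_pow m.+1).1.2 + (cubic_pow m.+1).2)%N.
  elim: m => // m.
  have -> : cubic_pow m.+2 = let: (u, v, w) := cubic_pow m.+1 in (w, u + w, v)%N by [].
  by case: (cubic_pow m.+1) => [[u v] w] /=; lia.
case: (cubic_pow m.+1) => [[u v] w] /= vw -> E; exfalso.
have [] := @cubic_norm_eq0 ((u * b)%:Z - a%:Z) (v * b)%:Z (w * b)%:Z.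
  apply/eqP; rewrite -(intr_eq0 R) (cubic_normE _ _ _ x3) mulf_eq0; apply/orP; left.
  by rewrite intrB -!pmulrn !natrM -E; apply/eqP; ring.
by move=> _ /eqP + /eqP; rewrite !eqz_nat !muln_eq0; lia.
Qed.

(** If [t <= t'], then [A^(t'-t)] divides [10^s * 9^(T-t)], to which [A] is coprime; so [t = t'],
    and the power of 10 follows. *)
Lemma monomial_nat_injective A T s t s' t' : (1 < A)%N -> coprime 10 A -> coprime 9 A ->
  (t <= T)%N -> (t' <= T)%N ->
  (10 ^ s * A ^ t * 9 ^ (T - t) = 10 ^ s' * A ^ t' * 9 ^ (T - t'))%N -> s = s' /\ t = t'.
Proof.
move=> A1 c10 c9; wlog tt' : s t s' t' / (t <= t')%N.
  move=> wl tT t'T E; have [tt'|/ltnW tt'] := leqP t t'; first exact: wl.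
  by have [] := wl s' t' s t tt' t'T tT (esym E).
move=> tT t'T E; have A0 := ltnW A1.
have tE : t' = t.
  have : (A ^ (t' - t) %| 10 ^ s * 9 ^ (T - t))%N.
    rewrite -(@dvdn_pmul2l (A ^ t)) ?expn_gt0 ?A0 // -expnD subnKC //.
    by rewrite [X in (_ %| X)%N]mulnCA mulnA E -mulnA mulnCA dvdn_mulr.
  rewrite -[X in (X %| _)%N]muln1 -{1}(subnKC tt') addKn muln1 => /gcdn_idPl.
  have /eqP -> : coprime (A ^ (t' - t)) (10 ^ s * 9 ^ (T - t)).
    by rewrite coprimeMr; apply/andP; split; apply: coprimeXl; apply: coprimeXr; rewrite coprime_sym.
  by move/esym/eqP; rewrite -(expn0 A) eqn_exp2l //; lia.
split=> //; move: E; rewrite tE => /eqP.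
rewrite !eqn_pmul2r ?expn_gt0 ?A0 // eqn_exp2l // => /eqP //.
Qed.

Lemma monomial_injective A T r s t r' s' t' : (1 < A)%N -> coprime 10 A -> coprime 9 A ->
  (t <= T)%N -> (t' <= T)%N ->
  (10 ^ s * A ^ t * 9 ^ (T - t))%:R * x ^+ r = (10 ^ s' * A ^ t' * 9 ^ (T - t'))%:R * x ^+ r' ->
  [/\ r = r', s = s' & t = t'].
Proof.
move=> A1 c10 c9 tT t'T.
have pos a b : (0 < 10 ^ a * A ^ b * 9 ^ (T - b))%N by rewrite !muln_gt0 !expn_gt0 (ltnW A1).
have x0 k : x ^+ k != 0 by rewrite expf_neq0 // gt_eqF // (lt_le_trans ltr01).
have main a b a' b' u v : (u <= v)%N ->
    (10 ^ a * A ^ b * 9 ^ (T - b))%:R * x ^+ u = (10 ^ a' * A ^ b' * 9 ^ (T - b'))%:R * x ^+ v -> u = v.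
  move=> uv E.
  have /cubic_pow_rational-/(_ (pos a' b')) : x ^+ (v - u) * (10 ^ a' * A ^ b' * 9 ^ (T - b'))%:R = (10 ^ a * A ^ b * 9 ^ (T - b))%:R.
    by apply: (mulfI (x0 u)); rewrite mulrA -exprD subnKC // [RHS]mulrC E mulrC.
  lia.
move=> E; have rr : r = r'.
  have [le|/ltnW le] := leqP r r'; first exact: main le E.
  exact: esym (main _ _ _ _ _ _ le (esym E)).
have E' : (10 ^ s * A ^ t * 9 ^ (T - t) = 10 ^ s' * A ^ t' * 9 ^ (T - t'))%N.
  by move: E; rewrite rr => /(mulIf (x0 _)) /eqP; rewrite eqr_nat => /eqP.
by have [-> ->] := monomial_nat_injective A1 c10 c9 tT t'T E'.
Qed.

End Irrationality.

(** * The auxiliary function on a box of exponents *)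

Section Box.
Variables (R : realType) (x : R).
Hypotheses (x3 : x ^+ 3 = x + 1) (x1 : 1 <= x) (x2 : x <= 2).
Variables (A n M S T l z : nat) (kappa : R).
Hypotheses (A_gt9 : (9 < A)%N) (coA10 : coprime 10 A) (coA9 : coprime 9 A).
Hypotheses (A_le : (A <= 2 ^ (4 * l))%N) (Tl_le : (T * l <= S)%N) (T_le : (T <= S)%N).
Hypothesis kappaE : 9 * x ^+ n = kappa * (A * 10 ^ M)%:R.
Hypotheses (kappa_half : 1 / 2 <= kappa) (kappa_le2 : kappa <= 2).
Hypothesis kappa_close : `|kappa - 1| * 2 ^+ z <= 1.

Definition box : finType := ('I_S * 'I_S * 'I_T : finType)%type.
Implicit Types q : box.

Definition boxX q : int := (q.1.1 + q.2 * n)%:Z.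
Definition boxY q : int := (nat_of_ord q.1.2)%:Z - (q.2 * M)%:Z.
Definition boxg q : int := (10 ^ q.1.2 * A ^ q.2 * 9 ^ (T - q.2))%:Z.
Definition boxr q : nat := q.1.1.
Definition boxW := eval_point x boxg boxr.
Definition boxlog := log_form boxX boxY (ln 9 * T%:R) (ln x) (ln (10 : R)).
(** The factors [x^r], [10^s] and [A^t 9^(T-t)] contribute at most [S], [4 S] and [4 S] bits; the
    last [S] accounts for [kappa^t]. *)
Definition boxH := (10 * S)%N.

Let x0 : 0 < x. Proof. exact: lt_le_trans x1. Qed.
Let A0 : (0 < A)%N. Proof. by lia. Qed.

Let k0 : 0 < kappa. Proof. by move: kappa_half; lra. Qed.

Lemma boxWE q : boxW q = 10 ^+ q.1.2 * A%:R ^+ q.2 * 9 ^+ (T - q.2) * x ^+ q.1.1.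
Proof. by rewrite /boxW /eval_point /boxg -pmulrn !natrM !natrX. Qed.

(** Substituting [9 x^n = kappa A 10^M] in the exponential of the linear form recovers [W] exactly,
    except for the factor [kappa^t]. *)
Lemma expR_boxlog q : expR (boxlog q) = boxW q * kappa ^+ q.2.
Proof.
have P (a : R) k : 0 < a -> expR (ln a * k%:R) = a ^+ k.
  by move=> a0; rewrite expRM_natr lnK.
have tT : (q.2 <= T)%N by apply: ltnW.
rewrite /boxlog /log_form /boxX /boxY boxWE intrB -!pmulrn mulrBr !expRD expRN.
rewrite !P // exprD [(_ * n)%N]mulnC [(_ * M)%N]mulnC !exprM -{1}(subnK tT) exprD.
have -> : kappa = 9 * x ^+ n / (A%:R * 10 ^+ M).
  rewrite kappaE natrM natrX mulfK // mulf_neq0 ?expf_neq0 ?pnatr_eq0 //; lia.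
rewrite !expr_div_n !exprMn.
have h10 : (10 ^+ M) ^+ q.2 != 0 :> R by rewrite !expf_neq0 // pnatr_eq0.
have hA : A%:R ^+ q.2 != 0 :> R by rewrite expf_neq0 // pnatr_eq0; lia.
by field; rewrite h10 hA.
Qed.

Lemma boxW_ge1 q : 1 <= boxW q.
Proof.
by rewrite boxWE !mulr_ege1 ?exprn_ege1 // ?ler1n.
Qed.

Lemma boxW_le q : boxW q <= 2 ^+ (9 * S).
Proof.
have tT : (q.2 <= T)%N by apply: ltnW.
have -> : (9 * S = S + 4 * S + 4 * S)%N by lia.
have h1 : x ^+ q.1.1 <= 2 ^+ S.
  apply: (@le_trans _ _ (2 ^+ q.1.1)); first by rewrite lerXn2r ?nnegrE ?(ltW x0).
  by rewrite ler_weXn2l ?ler1n // ltnW.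
have h2 : 10 ^+ q.1.2 <= 2 ^+ (4 * S) :> R.
  apply: (@le_trans _ _ (2 ^+ (4 * q.1.2))); last by rewrite ler_weXn2l ?ler1n // leq_mul2l ltnW.
  by rewrite exprM lerXn2r ?nnegrE ?exprn_ge0 //; lra.
have h3 : A%:R ^+ q.2 * 9 ^+ (T - q.2) <= 2 ^+ (4 * S) :> R.
  apply: (@le_trans _ _ (A%:R ^+ T)).
    rewrite -[X in _ <= _ ^+ X](subnKC tT) exprD ler_wpM2l ?exprn_ge0 //.
    by rewrite lerXn2r ?nnegrE // ler_nat ltnW.
  apply: (@le_trans _ _ ((2 ^+ (4 * l)) ^+ T)).
    by rewrite lerXn2r ?nnegrE ?exprn_ge0 // -natrX ler_nat.
  by rewrite -exprM ler_weXn2l ?ler1n //; lia.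
have p1 : 0 <= x ^+ q.1.1 by rewrite exprn_ge0 // ltW.
have h12 := ler_pM p1 (exprn_ge0 _ (ler0n _ 10)) h1 h2.
have p3 : 0 <= A%:R ^+ q.2 * 9 ^+ (T - q.2) :> R by rewrite mulr_ge0 ?exprn_ge0.
have := ler_pM (mulr_ge0 p1 (exprn_ge0 _ (ler0n _ 10))) p3 h12 h3.
by rewrite boxWE !exprD; apply: le_trans; rewrite le_eqVlt; apply/orP; left; apply/eqP; ring.
Qed.

Lemma kappa_pow_le k : kappa ^+ k <= 2 ^+ k.
Proof. by rewrite lerXn2r ?nnegrE // ltW. Qed.

Lemma exp_boxlog_le q : expR `|boxlog q| <= 2 ^+ boxH.
Proof.
have tS : (q.2 <= S)%N by apply: leq_trans T_le; apply: ltnW.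
have W0 : 0 < boxW q by apply: lt_le_trans (boxW_ge1 q).
case: (lerP 0 (boxlog q)) => h.
  rewrite ger0_norm // expR_boxlog /boxH (_ : (10 * S = 9 * S + S)%N); last by lia.
  rewrite exprD ler_pM ?boxW_le ?exprn_ge0 ?(ltW W0) ?(ltW k0) //.
  by rewrite (le_trans (kappa_pow_le _)) // ler_weXn2l // ler1n.
rewrite ltr0_norm // expRN expR_boxlog invfM.
apply: (@le_trans _ _ (1 * 2 ^+ q.2)).
  rewrite ler_pM ?invr_ge0 ?(ltW W0) ?exprn_ge0 ?(ltW k0) //.
    by rewrite invf_le1 // boxW_ge1.
  rewrite -exprVn lerXn2r ?nnegrE ?invr_ge0 ?(ltW k0) //.
  by rewrite -[_^-1]mul1r ler_pdivrMr //; move: kappa_half; lra.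
by rewrite mul1r ler_weXn2l ?ler1n // /boxH; lia.
Qed.

Lemma boxlog_le q : `|boxlog q| <= boxH%:R.
Proof.
rewrite leNgt; apply/negP => h.
have := exp_boxlog_le q; rewrite leNgt => /negP; apply.
apply: (@le_lt_trans _ _ (expR boxH%:R)); last by rewrite ltr_expR.
rewrite -[boxH%:R]mulr1 expRM_natl lerXn2r ?nnegrE ?expR_ge0 //.
by have := expR_ge1Dx (1 : R); lra.
Qed.

Lemma kappa_pow_close a : `|kappa ^+ a - 1| <= `|kappa - 1| * (2 ^+ a - 1).
Proof.
elim: a => [|a IH]; first by rewrite !expr0 !subrr normr0 mulr0.
have -> : kappa ^+ a.+1 - 1 = kappa * (kappa ^+ a - 1) + (kappa - 1) by rewrite exprS; ring.
rewrite (le_trans (ler_normD _ _)) // normrM (gtr0_norm k0) exprS.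
have := ler_pM (ltW k0) (normr_ge0 _) kappa_le2 IH; lra.
Qed.

Variable Kmax : nat.

Lemma boxlog_close q k : (k <= Kmax)%N ->
  `|expR (k%:R * boxlog q) - boxW q ^+ k| <= 2 ^+ (boxH * Kmax) / 2 ^+ z.
Proof.
move=> kK; rewrite expRM_natl expR_boxlog exprMn -exprM -{2}[boxW q ^+ k]mulr1 -mulrBr normrM.
have W0 : 0 <= boxW q ^+ k by rewrite exprn_ge0 // (le_trans ler01) // boxW_ge1.
have W1 : boxW q ^+ k <= 2 ^+ (9 * S * Kmax).
  apply: (@le_trans _ _ ((2 ^+ (9 * S)) ^+ k)).
    by rewrite lerXn2r ?nnegrE ?exprn_ge0 ?boxW_le // (le_trans ler01) // boxW_ge1.
  by rewrite -exprM ler_weXn2l ?ler1n // leq_mul2l kK orbT.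
have tS : (q.2 <= S)%N by apply: leq_trans T_le; apply: ltnW.
have h : `|kappa ^+ (q.2 * k) - 1| <= 2 ^+ (S * Kmax) / 2 ^+ z.
  rewrite (le_trans (kappa_pow_close _)) // mulrC.
  rewrite ler_pM // ?subr_ge0 ?exprn_ege1 ?ler1n //.
    apply: (@le_trans _ _ (2 ^+ (q.2 * k))); first by rewrite gerBl.
    by rewrite ler_weXn2l ?ler1n // leq_mul.
  by rewrite -[_^-1]mul1r ler_pdivlMr ?exprn_gt0.
have -> : (boxH * Kmax = 9 * S * Kmax + S * Kmax)%N by rewrite /boxH; lia.
by rewrite exprD -mulrA ler_pM // ger0_norm.
Qed.

Variables (Q K0 tau u : nat).
(** With this choice the term [7 H Q K] in the gain condition equals [d K], half of the available
    [2 d K]; the other half is left for [3 beta + 7]. *)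
Definition boxd := (7 * boxH * Q)%N.
Definition boxD := (8 * boxd)%N.
Hypotheses (S_gt0 : (0 < S)%N) (T_gt0 : (0 < T)%N) (Q_gt0 : (0 < Q)%N) (K0_gt0 : (0 < K0)%N).
Hypothesis siegel_card : (6 * boxD ^ 2 * K0 <= S ^ 2 * T)%N.
Hypothesis card_le : (S ^ 2 * T <= 2 ^ u)%N.
Hypotheses (X_le : (S + T * n <= 2 ^ tau)%N) (Y_le : (S + T * M <= 2 ^ tau)%N).

Lemma card_box : #|box| = (S ^ 2 * T)%N.
Proof. by rewrite !card_prod !card_ord; lia. Qed.

Lemma boxX_le q : `|boxX q| <= (2 ^ tau)%:Z.
Proof.
have h : (q.2 * n <= T * n)%N by rewrite leq_mul2r ltnW ?orbT.
have := ltn_ord q.1.1; rewrite /boxX; lia.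
Qed.

Lemma boxY_le q : `|boxY q| <= (2 ^ tau)%:Z.
Proof.
have h : (q.2 * M <= T * M)%N by rewrite leq_mul2r ltnW ?orbT.
have := ltn_ord q.1.2; rewrite /boxY; lia.
Qed.

Lemma boxXY_le i j q : `|boxX q ^+ i * boxY q ^+ j| <= (2 ^ (tau * (i + j)))%:Z.
Proof.
rewrite mulnDr expnD PoszM normrM !normrX !expnM.
by rewrite ler_pM ?exprn_ge0 // -[X in _ <= X]natz natrX natz lerXn2r ?nnegrE // (boxX_le, boxY_le).
Qed.

(** In bits: [1 + u + 2 tau D + H K0] for a Siegel solution, [tau D] for [X^i Y^j], and another [u]
    for summing over the box. *)
Definition boxbeta := (2 * u + 1 + 3 * tau * boxD + boxH * K0)%N.

Let cubic_coef (c : nat) (e : nat) : nat :=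
  nth 0%N [:: (cubic_pow e).1.1; (cubic_pow e).1.2; (cubic_pow e).2] c.

Let cubic_coef_le (c : 'I_3) e : (cubic_coef c e)%:R <= x ^+ e.
Proof.
have := cubic_pow_le x3 x1 e; rewrite /cubic_coef.
by case: (cubic_pow e) => [[u' v'] w'] [h0 h1 h2]; case: c => [[|[|[|c]]] hc].
Qed.

Let cubic_coefE e : x ^+ e = \sum_(c < 3) (cubic_coef c e)%:R * x ^+ c.
Proof.
rewrite !big_ord_recl big_ord0 /cubic_coef /=.
have := cubic_powE e x3; case: (cubic_pow e) => [[u' v'] w'] /= ->.
by rewrite addr0 /bump /= expr0 mulr1 expr1 addrA.
Qed.

Let siegel_bound k (c : 'I_3) q : (k < K0)%N ->
  `|boxg q ^+ k * (cubic_coef c (boxr q * k))%:Z| <= (2 ^ (boxH * K0))%:Z.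
Proof.
move=> kK; rewrite -(ler_int R) intr_norm intrM rmorphXn /= -!pmulrn.
rewrite ger0_norm ?mulr_ge0 ?exprn_ge0 // natrX.
apply: (@le_trans _ _ (boxW q ^+ k)).
  rewrite /boxW /eval_point exprMn -!pmulrn ler_wpM2l ?exprn_ge0 //.
  by rewrite -exprM cubic_coef_le.
apply: (@le_trans _ _ ((2 ^+ (9 * S)) ^+ k)).
  by rewrite lerXn2r ?nnegrE ?exprn_ge0 ?boxW_le // (le_trans ler01) // boxW_ge1.
by rewrite -exprM ler_weXn2l ?ler1n // /boxH leq_mul // ?leq_mul2r ?orbT // ltnW.
Qed.

(** One equation over [Q(x)] becomes three over the integers, one per coordinate in [1, x, x^2].
    This gives [3 D^2 K0] equations, hence the 6 in [siegel_card]. *)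
Lemma box_siegel : exists p : box -> int, [/\ exists q, p q != 0,
   forall i j, (i + j <= boxD)%N -> \sum_q `|(coefXY boxX boxY p i j q)%:~R| <= 2 ^+ boxbeta :> R &
   vanishing x boxX boxY p boxg boxr boxD K0].
Proof.
pose E : finType := ('I_boxD * 'I_boxD * 'I_K0 * 'I_3 : finType)%type.
pose a (e : E) (q : box) : int := boxX q ^+ e.1.1.1 * boxY q ^+ e.1.1.2 *
  (boxg q ^+ e.1.2 * (cubic_coef e.2 (boxr q * e.1.2))%:Z).
pose B := (2 ^ (2 * tau * boxD + boxH * K0))%N.
have := @siegel_lemma box E a B; rewrite card_box => [[]].
- by rewrite expn_gt0.
- by rewrite muln_gt0 expn_gt0 S_gt0.
- by rewrite !card_prod !card_ord; apply: leq_trans siegel_card; lia.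
- move=> e q; rewrite /a normrM /B expnD PoszM ler_pM //; last exact: siegel_bound.
  apply: (le_trans (boxXY_le _ _ _)); rewrite lez_nat leq_pexp2l //.
  rewrite [(2 * tau)%N]mulnC -mulnA leq_mul2l mul2n -addnn leq_add ?orbT //; exact: ltnW.
move=> p [p0 pB pE]; exists p; split=> //.
- move=> i j ij.
  apply: (@le_trans _ _ (\sum_(q : box) 2 ^+ (u + 1 + 3 * tau * boxD + boxH * K0))).
    apply: ler_sum => q _; rewrite -intr_norm -natrX pmulrn ler_int /coefXY -mulrA normrM.
    have -> : (u + 1 + 3 * tau * boxD + boxH * K0 =
      (1 + u + (2 * tau * boxD + boxH * K0)) + tau * boxD)%N by lia.
    rewrite expnD PoszM ler_pM //.
      apply: (le_trans (pB q)); rewrite lez_nat expnD leq_mul2r.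
      by apply/orP; right; rewrite [X in (_ <= X)%N]expnD leq_mul2l card_le orbT.
    by apply: (le_trans (boxXY_le _ _ _)); rewrite lez_nat leq_pexp2l // leq_mul2l ij orbT.
  rewrite sumr_const -[X in _ *+ X]/(#|box|) card_box -[_ *+ _]mulr_natr.
  have -> : boxbeta = (u + 1 + 3 * tau * boxD + boxH * K0 + u)%N by rewrite /boxbeta; lia.
  by rewrite [X in _ <= X]exprD ler_wpM2l ?exprn_ge0 // -natrX ler_nat.
- move=> i j k ij kK.
  have iD : (i < boxD)%N by apply: leq_ltn_trans ij; apply: leq_addr.
  have jD : (j < boxD)%N by apply: leq_ltn_trans ij; apply: leq_addl.
  rewrite /moment (eq_bigr (fun q => \sum_(c < 3)
    (p q * a (Ordinal iD, Ordinal jD, Ordinal kK, c) q)%:~R * x ^+ c)).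
    rewrite exchange_big big1 //= => c _.
    by rewrite -mulr_suml -raddf_sum /= pE mul0r.
  move=> q _; rewrite /eval_point exprMn -exprM cubic_coefE !mulr_sumr.
  apply: eq_bigr => c _; rewrite /a /coefXY /= !intrM !rmorphXn /= -!pmulrn; ring.
Qed.

Hypothesis gain : (3 * boxbeta + 7 <= boxd * K0)%N.
Hypothesis Kmax_ge : (Q ^ 7 * K0 <= Kmax)%N.
Hypothesis card_box_le : (S ^ 2 * T <= Q ^ 7 * K0)%N.
Variables (b Z : nat).
Hypotheses (H_le : (boxH <= 2 ^ b)%N) (Kmax_le : (Kmax * boxd.+1 + 1 <= 2 ^ b)%N).
Hypothesis Z_ge : (3 * boxbeta + 2 * (boxH * Kmax) + 10 + b * boxd * (Kmax + 1) <= Z)%N.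
Hypothesis z_ge : (boxH * Kmax + Z <= z)%N.

Lemma box_contradiction : False.
Proof.
have [p [[q0 p0] pC pV]] := box_siegel.
have it J : (J <= 7)%N -> vanishing x boxX boxY p boxg boxr (boxD - J * boxd) (Q ^ J * K0).
  elim: J => [|J IH] J7; first by rewrite mul0n subn0 expn0 mul1n.
  have DE : (boxD - J * boxd = boxD - J.+1 * boxd + boxd)%N.
    have : (J.+1 * boxd <= boxD)%N by rewrite leq_mul2r (leq_trans J7) ?orbT.
    by rewrite mulSn; move: boxD boxd (J * boxd)%N => a e k h; lia.
  rewrite expnS -mulnA.
  have QJ : (0 < Q ^ J)%N by rewrite expn_gt0 Q_gt0.
  have KJ : (K0 <= Q ^ J * K0)%N by rewrite leq_pmull.
  apply: (@vanishing_step R x x3 x1 x2 box boxX boxY p boxg boxr (ln 9 * T%:R) (ln x) (ln 10)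
    boxD boxH boxbeta Kmax (2 ^+ (boxH * Kmax) / 2 ^+ z) _ _ _ _ _ _ _ boxd Q _ _ b Z) => //.
  - by move=> q; rewrite (le_trans (boxW_le q)) // ler_weXn2l ?ler1n // /boxH leq_mul2r orbT.
  - exact: boxlog_le.
  - exact: exp_boxlog_le.
  - by rewrite divr_gt0 ?exprn_gt0.
  - by move=> q k; apply: boxlog_close.
  - by rewrite -DE leq_subr.
  - by rewrite muln_gt0 QJ.
  - rewrite mulnA -expnS; apply: leq_trans Kmax_ge; rewrite leq_mul2r leq_pexp2l ?orbT //.
  - have -> : (2 * (boxd * (Q ^ J * K0)) = boxd * (Q ^ J * K0) + 7 * boxH * (Q * (Q ^ J * K0)))%N.
      by rewrite /boxd; ring.
    rewrite addnAC leq_add2r; apply: (leq_trans gain); by rewrite leq_mul2l KJ orbT.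
  - rewrite mulrAC -exprD ler_pdivrMr ?exprn_gt0 // mul1r ler_weXn2l ?ler1n //.
  - by rewrite -DE; apply: IH; apply: ltnW.
have V : forall q, (p q)%:~R = 0 :> R.
  apply: (@vandermonde_eq0 _ _ boxW) => [q q'|k kI].
    rewrite !boxWE -!natrX -!natrM => E.
    have := monomial_injective x3 x1 x2 _ coA10 coA9 _ _ E.
    case=> [|||e1 e2 e3]; [by lia | exact: ltnW | exact: ltnW |].
    case: q q' e1 e2 e3 {E} => [[r s] t] [[r' s'] t'] /= /val_inj -> /val_inj -> /val_inj -> //.
  (* As [D = 8 d], seven steps leave [d > 0] orders, enough for the moments with [i = j = 0], which
     form the Vandermonde system. *)
  have D1 : (0 + 0 < boxD - 7 * boxd)%N.
    by rewrite subn_gt0 /boxD ltn_pmul2r // /boxd /boxH !muln_gt0 S_gt0 Q_gt0.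
  have k7 : (k < Q ^ 7 * K0)%N by apply: leq_trans card_box_le; rewrite -card_box.
  rewrite -[RHS](it 7 (leqnn 7) 0%N 0%N k D1 k7).
  by apply: eq_bigr => q _; rewrite /coefXY !expr0 !mulr1.
by have := V q0; move/eqP; rewrite intr_eq0 (negbTE p0).
Qed.

End Box.

(** * Numerical choice of the parameters *)

Section ParameterChoice.
Local Open Scope nat_scope.
Variables (C l w Q : nat).
Let K0 := 1280 * w.
Let T := C * K0 * Q ^ 2.
Let S := T * l.
Hypotheses (l_gt0 : 0 < l) (w_gt0 : 0 < w) (C_ge : 6 * 560 ^ 2 <= C) (Q_ge : C ^ 3 * K0 ^ 2 * l ^ 2 * w <= Q).

Let C0 : 5000 <= C. Proof. by apply: leq_trans C_ge; lia. Qed.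
Let C1 : 0 < C. Proof. by apply: leq_trans C0. Qed.
Let K1 : 0 < K0. Proof. by rewrite muln_gt0. Qed.
Let Q1 : 0 < Q. Proof. by apply: leq_trans Q_ge; rewrite !muln_gt0 C1 l_gt0 w_gt0. Qed.

Let CKl_le : C ^ 2 * K0 * l <= Q.
Proof.
apply: leq_trans Q_ge; rewrite -[X in X <= _]muln1; apply: leq_mul => //.
apply: leq_mul; last by rewrite leq_pmulr.
by apply: leq_mul; [rewrite leq_pexp2l | rewrite leq_pmulr].
Qed.

Let CK_le : C ^ 2 * K0 <= Q.
Proof. by apply: leq_trans CKl_le; rewrite leq_pmulr. Qed.

Let CKl1_le : C * K0 * l <= Q.
Proof.
apply: leq_trans CKl_le; rewrite leq_mul2r leq_mul2r; apply/orP; right; apply/orP; right.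
by rewrite -[X in X <= _]expn1 leq_pexp2l.
Qed.

Let S_le : S <= Q ^ 3.
Proof.
have -> : S = (C * K0 * l) * Q ^ 2 by rewrite /S /T; ring.
by rewrite [Q ^ 3]expnS leq_mul2r CKl1_le orbT.
Qed.

Let C_le : C <= Q.
Proof.
apply: leq_trans CKl1_le; rewrite -mulnA leq_pmulr // muln_gt0 K1 //.
Qed.

Let Q8 : 2 <= Q. Proof. by apply: leq_trans C_le; apply: leq_trans C0. Qed.

Let twice a : 2 * Q ^ a <= Q ^ a.+1. Proof. by rewrite expnS leq_mul2r Q8 orbT. Qed.

(** [560 = 8 * 7 * 10] comes from [boxD]; the definition of [T] is made for this inequality. *)
Lemma parameters_siegel : 6 * (8 * (7 * (10 * S) * Q)) ^ 2 * K0 <= S ^ 2 * T.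
Proof.
have -> : 6 * (8 * (7 * (10 * S) * Q)) ^ 2 * K0 = 6 * 560 ^ 2 * (S ^ 2 * K0 * Q ^ 2) by ring.
have -> : S ^ 2 * T = C * (S ^ 2 * K0 * Q ^ 2) by rewrite /T; ring.
by rewrite leq_mul2r C_ge orbT.
Qed.

(** [S^2 T] equals [C^3 K0^3 l^2 Q^6]; the seventh power of [Q] absorbs the remaining constants. *)
Lemma parameters_card : S ^ 2 * T <= Q ^ 7 * K0.
Proof.
have -> : S ^ 2 * T = (C ^ 3 * K0 ^ 2 * l ^ 2) * (Q ^ 6 * K0) by rewrite /S /T; ring.
have -> : Q ^ 7 * K0 = Q * (Q ^ 6 * K0) by ring.
by rewrite leq_mul2r (leq_trans _ Q_ge) ?orbT // leq_pmulr.
Qed.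

Lemma parameters_linear n : n <= C * Q ^ 12 -> S + T * n <= Q ^ 16.
Proof.
move=> hn; apply: leq_trans (twice 15); rewrite mul2n -addnn leq_add //.
  by apply: (leq_trans S_le); rewrite leq_pexp2l.
apply: (@leq_trans (T * (C * Q ^ 12))); first by rewrite leq_mul2l hn orbT.
have -> : T * (C * Q ^ 12) = (C ^ 2 * K0) * Q ^ 14 by rewrite /T; ring.
by rewrite [Q ^ 15]expnS leq_mul2r CK_le orbT.
Qed.

Let d := 7 * (10 * S) * Q.
Let beta := 2 * (8 * w) + 1 + 3 * (16 * w) * (8 * d) + 10 * S * K0.

Let S1 : 0 < S. Proof. by rewrite !muln_gt0 C1 l_gt0 w_gt0 Q1. Qed.

Let C_le_Q : 5000 <= Q. Proof. by apply: leq_trans C_le; apply: C0. Qed.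

(** The dominant part of [3 beta] is [3 * 3 * 16 * 8 w d = 1152 w d]; the factor 1280 in [K0] leaves
    a tenth of the right-hand side for the other terms. *)
Lemma parameters_gain : 3 * beta + 7 <= d * K0.
Proof.
have h1 : 5000 * (w * S) <= Q * (w * S) by rewrite leq_mul2r C_le_Q orbT.
have h2 : w <= w * S by rewrite leq_pmulr.
rewrite /beta /d /K0.
have -> : 3 * (2 * (8 * w) + 1 + 3 * (16 * w) * (8 * (7 * (10 * S) * Q)) + 10 * S * (1280 * w)) + 7
  = 48 * w + 10 + 63 * 1280 * (Q * (w * S)) + 30 * 1280 * (w * S) by ring.
have -> : 7 * (10 * S) * Q * (1280 * w) = 70 * 1280 * (Q * (w * S)) by ring.
move: h1 h2 w_gt0; clear; move: (Q * (w * S)) (w * S) => a b; lia.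
Qed.

Let Kmax := Q ^ 7 * K0.

Let d_le : d.+1 <= Q ^ 5.
Proof.
apply: leq_trans (twice 4); rewrite mul2n -addnn -addn1 leq_add ?expn_gt0 ?Q1 //.
have -> : d = 70 * S * Q by rewrite /d; ring.
have -> : Q ^ 4 = Q ^ 3 * Q by ring.
rewrite leq_mul2r; apply/orP; right.
have -> : S = (C * K0 * l) * Q ^ 2 by rewrite /S /T; ring.
have -> : Q ^ 3 = Q * Q ^ 2 by ring.
rewrite mulnA leq_mul2r; apply/orP; right; apply: leq_trans CKl_le.
have -> : C ^ 2 * K0 * l = C * (C * K0 * l) by ring.
by rewrite leq_mul2r (leq_trans _ C0) ?orbT //; lia.
Qed.

Lemma parameters_Kmax : Q ^ 7 * K0 <= Q ^ 8.
Proof.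
have -> : Q ^ 8 = Q ^ 7 * Q by ring.
rewrite leq_mul2l (leq_trans _ CK_le) ?orbT // leq_pmull // expn_gt0 C1 //.
Qed.

Lemma parameters_height : 10 * S <= Q ^ 16.
Proof.
apply: (@leq_trans (Q ^ 5)); last by rewrite leq_pexp2l.
apply: (leq_trans _ d_le); rewrite /d.
have : S <= S * Q by rewrite leq_pmulr.
have -> : 7 * (10 * S) * Q = 70 * (S * Q) by ring.
clear; lia.
Qed.

Lemma parameters_node : Kmax * d.+1 + 1 <= Q ^ 16.
Proof.
apply: leq_trans (twice 15); rewrite mul2n -addnn leq_add ?expn_gt0 ?Q1 //.
apply: (@leq_trans (Q ^ 8 * Q ^ 5)); first exact: leq_mul parameters_Kmax d_le.
by rewrite -expnD leq_pexp2l.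
Qed.

(** The dominant term is of order [w d Kmax], that is [Q^10] times a quantity below [Q]; this is the
    origin of the exponent 11. *)
Lemma parameters_total :
  10 * S * Kmax + (3 * beta + 2 * (10 * S * Kmax) + 10 + 16 * w * d * (Kmax + 1)) <= Q ^ 11.
Proof.
have Km1 : 0 < Kmax by rewrite muln_gt0 expn_gt0 Q1 K1.
have h0 : 3 * beta + 7 <= d * Kmax.
  by apply: (leq_trans parameters_gain); rewrite leq_mul2l leq_pmull ?orbT // expn_gt0 Q1.
have h1 : 10 * S * Kmax <= d * Kmax.
  rewrite leq_mul2r; apply/orP; right; by rewrite /d mulnAC leq_pmull // muln_gt0 Q1.
have h2 : d * Kmax <= w * (d * Kmax) by rewrite leq_pmull.
have h3 : 16 * w * d * (Kmax + 1) <= 32 * (w * (d * Kmax)).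
  have -> : 16 * w * d * (Kmax + 1) = 16 * (w * (d * Kmax)) + 16 * (w * d) by ring.
  have : w * d <= w * (d * Kmax) by rewrite leq_mul2l leq_pmulr ?orbT.
  by clear; lia.
have h5 : 10 * S <= d by rewrite /d mulnAC leq_pmull // muln_gt0 Q1.
have S10 : 0 < 10 * S by move: S1; clear; case: S => // k _; rewrite muln_gt0.
have h4 : 0 < d * Kmax.
  by rewrite muln_gt0 Km1 andbT (leq_trans _ h5).
apply: (@leq_trans (40 * (w * (d * Kmax)))).
  move: h0 h1 h2 h3 h4; clear; move: (16 * w * d * _) (w * (d * Kmax)) (d * Kmax) (10 * S * Kmax) => x y z t.
  lia.
have -> : 40 * (w * (d * Kmax)) = 2800 * (C * K0 ^ 2 * l * w) * Q ^ 10.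
  by rewrite /d /Kmax /S /T; ring.
rewrite [Q ^ 11]expnS leq_mul2r; apply/orP; right; apply: leq_trans Q_ge.
have -> : C ^ 3 * K0 ^ 2 * l ^ 2 * w = (C ^ 2 * l) * (C * K0 ^ 2 * l * w) by ring.
rewrite leq_mul2r; apply/orP; right; apply: (@leq_trans C); first by apply: leq_trans C0.
by apply: (@leq_trans (C ^ 2)); rewrite ?leq_pmulr // -[X in X <= _]expn1 leq_pexp2l.
Qed.
End ParameterChoice.

Theorem no_close_approximation (R : realType) (x : R) (A n M l w C : nat) (kappa : R) :
  x ^+ 3 = x + 1 -> 1 <= x -> x <= 2 ->
  (0 < l)%N -> (0 < w)%N -> (6 * 560 ^ 2 <= C)%N ->
  (C ^ 3 * (1280 * w) ^ 2 * l ^ 2 * w <= 2 ^ w)%N ->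
  (9 < A)%N -> coprime 10 A -> coprime 9 A -> (A <= 2 ^ (4 * l))%N ->
  (M <= n)%N -> (n <= C * 2 ^ (12 * w))%N ->
  9 * x ^+ n = kappa * (A * 10 ^ M)%:R -> 1 / 2 <= kappa -> kappa <= 2 ->
  `|kappa - 1| * 2 ^+ (2 ^ (11 * w)) <= 1 -> False.
Proof.
move=> x3 x1 x2 l0 w0 C0 hQ A9 c10 c9 Al Mn nC kE k1 k2 kc.
have E a : (2 ^ (a * w) = (2 ^ w) ^ a)%N by rewrite -expnM mulnC.
have Cp : (0 < C)%N by apply: leq_trans C0.
have Q0 : (0 < 2 ^ w)%N by rewrite expn_gt0.
have T0 : (0 < C * (1280 * w) * (2 ^ w) ^ 2)%N by rewrite !muln_gt0 Cp w0 Q0.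
have S0 : (0 < C * (1280 * w) * (2 ^ w) ^ 2 * l)%N by rewrite muln_gt0 T0.
have pc := parameters_card w0 hQ.
have lin k : (k <= n)%N -> (C * (1280 * w) * (2 ^ w) ^ 2 * l + C * (1280 * w) * (2 ^ w) ^ 2 * k <= 2 ^ (16 * w))%N.
  by move=> kn; rewrite E; apply: parameters_linear => //; rewrite (leq_trans kn) // -E.
rewrite E in kc.
apply: (box_contradiction x3 x1 x2 A9 c10 c9 Al (leqnn _) _ kE k1 k2 kc S0 T0 Q0 _ _ _ (lin _ (leqnn n)) (lin _ Mn)
  (Kmax := ((2 ^ w) ^ 7 * (1280 * w))%N) (b := (16 * w)%N) (u := (8 * w)%N) (K0 := (1280 * w)%N)
  _ (leqnn _) pc _ _ (leqnn _)).
- by rewrite leq_pmulr.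
- by rewrite muln_gt0.
- exact: parameters_siegel.
- by rewrite (leq_trans pc) // E; apply: parameters_Kmax w0 C0 hQ.
- exact: parameters_gain hQ.
- by rewrite E; apply: parameters_height hQ.
- by rewrite E; apply: parameters_node hQ.
- exact: parameters_total hQ.
Qed.

(** * Growth of the Perrin numbers *)

Lemma plastic_number_exists (R : rcfType) : exists x : R, [/\ x ^+ 3 = x + 1, 1 <= x & x <= 2].
Proof.
have [||x /andP[x1 x2] /rootP] := @poly_ivt R ('X ^+ 3 - 'X - 1) 1 2.
- lra.
- by rewrite !hornerE; apply/andP; split; lra.
rewrite !hornerE => h; exists x; split=> //; lra.
Qed.

Lemma perrinS n : perrin n.+3 = (perrin n.+1 + perrin n)%N.
Proof. by []. Qed.

Section PerrinAsymptotics.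
Variables (R : realFieldType) (x : R).
Hypotheses (x3 : x ^+ 3 = x + 1) (x1 : 1 <= x) (x2 : x <= 2).

Let delta n : R := (perrin n)%:R - x ^+ n.

Let deltaS n : delta n.+3 = delta n.+1 + delta n.
Proof. by rewrite /delta perrinS natrD (exprD x 3 n) x3 [x ^+ n.+1]exprS; ring. Qed.

(* Dividing [t^3 - t - 1] by [t - x] leaves [t^2 + x t + (x^2 - 1)], which
   annihilates the contribution of the two complex conjugate roots. *)
Let delta_rec n : delta n.+2 = - x * delta n.+1 - (x ^+ 2 - 1) * delta n.
Proof.
elim: n => [|n IH]; first by rewrite /delta /= expr0 expr1; ring.
rewrite deltaS IH; have := x3; rewrite exprS => h.
have -> : - x * (- x * delta n.+1 - (x ^+ 2 - 1) * delta n) - (x ^+ 2 - 1) * delta n.+1 =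
  (x * x ^+ 2 - x) * delta n + delta n.+1 by ring.
by rewrite h; ring.
Qed.

(** [E] is the quadratic form attached to the second-order recurrence of [delta]; a shift multiplies
    it by [x^2 - 1], the product of the two complex roots, which is at most 1. Completing the square
    shows that it dominates [delta^2 / 5], so [delta^2 <= 20/3]. *)
Lemma perrin_close n : `|(perrin n)%:R - x ^+ n| <= 3.
Proof.
pose E k := delta k.+1 ^+ 2 + x * delta k.+1 * delta k + (x ^+ 2 - 1) * delta k ^+ 2.
have h3 : x * (x * x) = x + 1 by rewrite -x3; ring.
have xlo : 13 / 10 <= x.
  rewrite leNgt; apply/negP => h; have h' : x * x <= 169 / 100 by nra.
  by have : x * (x * x) <= x * (169 / 100); [rewrite ler_wpM2l // (le_trans ler01) | lra].
have xhi : x <= 4 / 3.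
  rewrite leNgt; apply/negP => h; have h' : 16 / 9 <= x * x by nra.
  by have : x * (16 / 9) <= x * (x * x); [rewrite ler_wpM2l // (le_trans ler01) | lra].
have ES k : E k.+1 = (x ^+ 2 - 1) * E k by rewrite /E delta_rec; ring.
have xx : 0 <= x ^+ 2 - 1 <= 1 by rewrite expr2; apply/andP; split; nra.
have E0 : E 0%N = 3 * x ^+ 2 - 4 by rewrite /E /delta /= expr0 expr1; ring.
have E0' : 0 <= E 0%N <= 4 / 3.
  by rewrite E0 expr2; apply/andP; split; nra.
have En k : 0 <= E k <= 4 / 3.
  elim: k => // k /andP[k1 k2]; case/andP: xx => xx1 xx2; rewrite ES mulr_ge0 //=.
  by rewrite (le_trans _ k2) // ler_piMl.
have := En n; rewrite -/(delta n) => /andP[_].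
have -> : E n = (delta n.+1 + x / 2 * delta n) ^+ 2 + (3 / 4 * (x * x) - 1) * (delta n * delta n).
  by rewrite /E; field.
have xx3 : 1 / 5 <= 3 / 4 * (x * x) - 1 by nra.
have := sqr_ge0 (delta n.+1 + x / 2 * delta n); move: (_ ^+ 2) => t t0 h.
have d2 : delta n * delta n <= 9.
  have d0 : 0 <= delta n * delta n by rewrite -expr2 sqr_ge0.
  by have := ler_wpM2r d0 xx3; lra.
by rewrite leNgt; apply/negP; rewrite lter_normr => /orP[] ?; nra.
Qed.
End PerrinAsymptotics.

From mathcomp Require Import Rstruct.

(** * From a long palindrome to a close approximation *)

Section NatBounds.
Local Open Scope nat_scope.

Lemma fifth_power_le_exp w : 249 <= w -> 2 ^ 90 * w ^ 5 <= 2 ^ w.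
Proof.
move=> /subnKC <-; elim: (w - 249) => [|k IH].
  by rewrite addn0; lia.
rewrite addnS [2 ^ (249 + k).+1]expnS; move: IH; have : 249 <= 249 + k by rewrite leq_addr.
move: (249 + k) => v v249 IH; apply: (@leq_trans (2 * (2 ^ 90 * v ^ 5))); last by rewrite leq_mul2l.
rewrite mulnCA leq_mul2l; apply/orP; right.
have h1 : v <= v ^ 2 by rewrite -{1}[v]expn1 leq_pexp2l //; lia.
have h2 : v ^ 2 <= v ^ 3 by rewrite leq_pexp2l //; lia.
have h3 : v ^ 3 <= v ^ 4 by rewrite leq_pexp2l //; lia.
have h5 : 249 * v ^ 4 <= v ^ 5 by rewrite [v ^ 5]expnS leq_mul2r v249 orbT.
have -> : v.+1 ^ 5 = v ^ 5 + 5 * v ^ 4 + 10 * v ^ 3 + 10 * v ^ 2 + 5 * v + 1 by rewrite -addn1; ring.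
move: h1 h2 h3 h5 v249; clear; move: (v ^ 2) (v ^ 3) (v ^ 4) (v ^ 5) => a b c d; lia.
Qed.

Lemma parameter_bound w l : 249 <= w -> l <= 7 * w ->
  (2 ^ 21) ^ 3 * (1280 * w) ^ 2 * l ^ 2 * w <= 2 ^ w.
Proof.
move=> w249 lw; apply: leq_trans (fifth_power_le_exp w249).
apply: (@leq_trans ((2 ^ 21) ^ 3 * (1280 * w) ^ 2 * (7 * w) ^ 2 * w)).
  by rewrite leq_mul2r leq_mul2l leq_exp2r // lw !orbT.
have -> : (2 ^ 21) ^ 3 * (1280 * w) ^ 2 * (7 * w) ^ 2 * w = 2 ^ 63 * (1280 ^ 2 * 7 ^ 2) * w ^ 5.
  by rewrite -expnM; ring.
have -> : 2 ^ 90 = 2 ^ 63 * 2 ^ 27 by rewrite -expnD.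
by rewrite leq_mul2r leq_mul2l; apply/orP; right; apply/orP; right; lia.
Qed.

(** Weakening [5^(l-2)] to [4^(l-2)] gives [2 (l - 2) < 12 w + 12], which for [l >= 1499] forces
    [w >= 249]; then [l + 1 <= 6 w + 8 <= 7 w]. *)
Lemma logarithmic_bound l n w : 1499 <= l -> 5 ^ (l - 2) <= n -> n < 2 ^ (12 * w).+4.+4.+4 ->
  249 <= w /\ l.+1 <= 7 * w.
Proof.
move=> l0 h1 h2.
have : 2 ^ (2 * (l - 2)) < 2 ^ (12 * w).+4.+4.+4.
  by apply: leq_ltn_trans h2; apply: leq_trans h1; rewrite expnM leq_exp2r //; lia.
rewrite ltn_exp2l // => h; split; lia.
Qed.

End NatBounds.

Lemma mul_exp2_le1 (R : realFieldType) (a : R) z M : 0 <= a -> (z <= M)%N ->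
  a * (4 * (10 ^ M)%:R) <= 1 -> a * 2 ^+ z <= 1.
Proof.
move=> a0 zM; apply: le_trans; apply: ler_wpM2l => //.
have h : 2 ^+ z <= (10 ^ M)%:R :> R.
  rewrite -natrX ler_nat; apply: (@leq_trans (2 ^ M)); first by rewrite leq_pexp2l.
  by case: M {zM} => // k; rewrite leq_exp2r.
have := ler0n R (10 ^ M); lra.
Qed.

(** The equation reads [9 P_n + 9 = A * 10^M + 10^l]. Hence [9 x^n] differs from [A * 10^M] by at
    most [2 * 10^l], while [A >= 8 * 10^l]: the relative error is at most [10^-M / 4]. *)
Lemma nine_palindrome_large (n l m : nat) :
  (9 * perrin n + 9 + 10 ^ (l + m) = 9 * 10 ^ (2 * l + m) + 10 ^ l)%N ->
  (1499 <= l)%N -> (5 ^ (l - 2) <= n)%N -> False.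
Proof.
move=> hP l0 hn; set M := (l + m)%N.
have n0 : (0 < n)%N by apply: leq_trans hn; rewrite expn_gt0.
pose w := (trunc_log 2 n %/ 12)%N.
have wn : (2 ^ (12 * w) <= n)%N.
  apply: leq_trans (trunc_logP (isT : (1 < 2)%N) n0).
  by rewrite leq_pexp2l // mulnC leq_trunc_div.
have nw : (n < 2 ^ (12 * w).+4.+4.+4)%N.
  apply: leq_trans (trunc_log_ltn n (isT : (1 < 2)%N)) _.
  by rewrite leq_pexp2l // /w; lia.
have [w249 lw] := logarithmic_bound l0 hn nw.
pose A := (9 * 10 ^ l - 1)%N.
have l10 : (100 <= 10 ^ l)%N.
  by apply: (@leq_trans (10 ^ 2)); rewrite // leq_pexp2l //; lia.
have AE : (A.+1 = 9 * 10 ^ l)%N by rewrite /A; lia.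
have A8 : (8 * 10 ^ l <= A)%N by lia.
have A9 : (9 < A)%N by lia.
have cop p : (p %| 9 * 10 ^ l)%N -> coprime p A.
  move=> pA; rewrite coprime_sym; have := coprimenS A; rewrite AE.
  exact: coprime_dvdr.
have c10 : coprime 10 A by apply: cop; rewrite dvdn_mull // dvdn_exp //; lia.
have c9 : coprime 9 A by apply: cop; rewrite dvdn_mulr.
have Al : (A <= 2 ^ (4 * l.+1))%N.
  apply: (@leq_trans (10 * 10 ^ l)); first by lia.
  by rewrite -expnS expnM leq_exp2r.
have [x [x3 x1 x2]] := plastic_number_exists Rdefinitions.R.
have d3 := perrin_close x3 x1 n.
pose B : Rdefinitions.R := (A * 10 ^ M)%:R.
have hP' : (9 * perrin n + 9 = A * 10 ^ M + 10 ^ l)%N.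
  have : (A.+1 * 10 ^ M = 9 * 10 ^ (2 * l + m))%N.
    by rewrite AE -mulnA -expnD /M addnA addnn -mul2n.
  rewrite mulSn => e; move: hP; rewrite -e -/M; clear; lia.
have eP : 9 * (perrin n)%:R + 9 = B + (10 ^ l)%:R :> Rdefinitions.R.
  by rewrite /B -natrD -hP' natrD natrM.
have B8 : 4 * (10 ^ M)%:R * (2 * (10 ^ l)%:R) <= B.
  rewrite /B natrM; have : 8 * (10 ^ l)%:R <= A%:R :> Rdefinitions.R by rewrite -natrM ler_nat.
  have : 0 <= (10 ^ M)%:R :> Rdefinitions.R by []. 
  nra.
have tl : 100 <= (10 ^ l)%:R :> Rdefinitions.R by rewrite ler_nat.
have tM : 1 <= (10 ^ M)%:R :> Rdefinitions.R by rewrite ler1n expn_gt0.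
have B0 : 0 < B by nra.
pose kappa := 9 * x ^+ n / B.
have kE : 9 * x ^+ n = kappa * B by rewrite /kappa divfK // gt_eqF.
have close : `|kappa - 1| * (4 * (10 ^ M)%:R) <= 1.
  have h : `|kappa - 1| * B <= 2 * (10 ^ l)%:R.
    rewrite -[X in _ * X <= _](gtr0_norm B0) -normrM mulrBl mul1r -kE.
    by move: d3; rewrite !ler_norml; lra.
  have h2 := ler_wpM2l (normr_ge0 (kappa - 1)) B8.
  rewrite -(@ler_pM2r _ (2 * (10 ^ l)%:R)); last by lra.
  by rewrite mul1r -mulrA; apply: le_trans h2 h.
have k4 : `|kappa - 1| <= 1 / 4.
  by have := ler_wpM2l (normr_ge0 (kappa - 1)) tM; move: close; lra.
have k1 : 1 / 2 <= kappa by move: k4; rewrite ler_norml; lra.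
have k2 : kappa <= 2 by move: k4; rewrite ler_norml; lra.
have Bx : B <= 18 * x ^+ n by nra.
have xB : 9 * x ^+ n <= 2 * B by nra.
have Mn : (M <= n)%N.
  have h : (10 ^ M)%:R <= 2 ^+ n :> Rdefinitions.R.
    have : x ^+ n <= 2 ^+ n by rewrite lerXn2r ?nnegrE // (le_trans ler01).
    nra.
  have : (10 ^ M <= 2 ^ n)%N by rewrite -(ler_nat Rdefinitions.R) [X in _ <= X]natrX.
  move=> h'; rewrite -(@leq_exp2l 2) //; apply: leq_trans h'.
  by case: (M) => // k; rewrite leq_exp2r.
(* [x^3 = x + 1 >= 2] gives [2^(n/3) <= x^n], and [10 <= 2^4] bounds the other side; so [M] is at
   least about [n / 12], up to a multiple of [l]. *)
have nM : (n %/ 3 <= 4 * M + 4 * l + 1)%N.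
  rewrite -(@leq_exp2l 2) // -(ler_nat Rdefinitions.R).
  have hx : 2 ^+ (n %/ 3) <= x ^+ n.
    apply: (@le_trans _ _ ((x ^+ 3) ^+ (n %/ 3))).
      by rewrite x3 lerXn2r ?nnegrE //; lra.
    by rewrite -exprM ler_weXn2l // mulnC leq_trunc_div.
  rewrite !natrX (le_trans hx) //.
  have : B <= 9 * (10 ^ l)%:R * (10 ^ M)%:R.
    by rewrite /B -!natrM ler_nat -AE leq_mul2r leqnSn orbT.
  have -> : 2 ^+ (4 * M + 4 * l + 1) = 2 * (2 ^+ 4) ^+ l * (2 ^+ 4) ^+ M :> Rdefinitions.R.
    by rewrite -!exprM -[X in X * _ * _]expr1 -!exprD; congr (_ ^+ _); ring.
  have p a : (10 ^ a)%:R <= (2 ^+ 4) ^+ a :> Rdefinitions.R.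
    by rewrite natrX lerXn2r ?nnegrE ?exprn_ge0 // -natrX ler_nat.
  have := ler_pM (ler0n _ _) (ler0n _ _) (p l) (p M); lra.
have hM : (2 ^ (11 * w) <= M)%N.
  rewrite leqNgt; apply/negP => h.
  have e : (2 ^ (12 * w) = 2 ^ w * 2 ^ (11 * w))%N by rewrite -expnD -mulSn.
  have e1 : (w < 2 ^ w)%N by apply: ltn_expl.
  have e2 : (2 ^ w <= 2 ^ (11 * w))%N by rewrite leq_pexp2l // leq_pmull.
  have e3 : (249 * 2 ^ (11 * w) <= 2 ^ w * 2 ^ (11 * w))%N by rewrite leq_mul2r (leq_trans w249 (ltnW e1)) orbT.
  have n3 : (n < 3 * (n %/ 3).+1)%N by rewrite mulnC ltn_ceil.
  move: e1 e2 e3 h nM wn lw n3; rewrite e; clear.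
  move: (2 ^ w * 2 ^ (11 * w))%N (2 ^ w)%N (2 ^ (11 * w))%N (n %/ 3)%N => a b c d.
  lia.
have nC : (n <= 2 ^ 21 * 2 ^ (12 * w))%N.
  by apply: ltnW; apply: (leq_trans nw); rewrite -expnD leq_pexp2l //; clear; move: (12 * w)%N => t; lia.
(* [2^21] is the least power of two above [6 * 560^2]. *)
have C_ge : (6 * 560 ^ 2 <= 2 ^ 21)%N by clear; lia.
have hw := parameter_bound w249 lw.
have kc : `|kappa - 1| * 2 ^+ (2 ^ (11 * w)) <= 1.
  exact: mul_exp2_le1 (normr_ge0 _) hM close.
have w0 : (0 < w)%N by apply: leq_trans w249.
move: nC C_ge hw; move: (2 ^ 21)%N => C nC C_ge hw.
exact: (no_close_approximation x3 x1 x2 (ltn0Sn l) w0 C_ge hw A9 c10 c9 Al Mn nC kE k1 k2 kc).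
Qed.

(** * 5-adic behaviour of the Perrin numbers *)

Definition perrin_like (f : nat -> int) := forall n, f n.+3 = f n.+1 + f n.

Lemma perrin_like_ind3 (P : nat -> Prop) : P 0%N -> P 1%N -> P 2%N ->
  (forall n, P n -> P n.+1 -> P n.+3) -> forall n, P n.
Proof.
move=> P0 P1 P2 PS n; suff [] : [/\ P n, P n.+1 & P n.+2] by [].
by elim: n => // n [h0 h1 h2]; split=> //; apply: PS.
Qed.

Lemma perrin_like_ext f g : perrin_like f -> perrin_like g ->
  f 0%N = g 0%N -> f 1%N = g 1%N -> f 2%N = g 2%N -> f =1 g.
Proof.
by move=> hf hg f0 f1 f2; apply: perrin_like_ind3 => // n h0 h1; rewrite hf hg h0 h1.
Qed.

Lemma perrin_like_dvd (d : int) f : perrin_like f ->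
  (d %| f 0%N)%Z -> (d %| f 1%N)%Z -> (d %| f 2%N)%Z -> forall n, (d %| f n)%Z.
Proof.
by move=> hf f0 f1 f2; apply: perrin_like_ind3 => // n h0 h1; rewrite hf rpredD.
Qed.

Lemma perrin_like_shift f k : perrin_like f -> perrin_like (fun x => f (x + k)%N - f x).
Proof. by move=> hf n; rewrite !addSn !hf; ring. Qed.

Fixpoint perrin_seq (n : nat) (a b c : int) : int :=
  if n is n'.+1 then perrin_seq n' b c (a + b) else a.

Lemma perrin_seq_like a b c : perrin_like (fun n => perrin_seq n a b c).
Proof. by move=> n; elim: n a b c => [|n IH] a b c; [rewrite /= addrC | exact: IH]. Qed.

Lemma perrin_likeE f : perrin_like f -> f =1 fun n => perrin_seq n (f 0%N) (f 1%N) (f 2%N).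
Proof. by move=> hf; apply: perrin_like_ext => //; apply: perrin_seq_like. Qed.

Lemma perrin_seq_linear n a b c : perrin_seq n a b c =
  a * perrin_seq n 1 0 0 + b * perrin_seq n 0 1 0 + c * perrin_seq n 0 0 1.
Proof.
move: n; apply: perrin_like_ext => /=; rewrite ?mulr0 ?mulr1 ?add0r ?addr0 //.
- exact: perrin_seq_like.
- by move=> n; rewrite !perrin_seq_like; ring.
Qed.

Fixpoint perrin_seq_mod (q : int) (n : nat) (a b c : int) : int :=
  if n is n'.+1 then perrin_seq_mod q n' b c ((a + b) %% q)%Z else a.

Lemma perrin_seq_modP q n a b c a' b' c' :
  (q %| a - a')%Z -> (q %| b - b')%Z -> (q %| c - c')%Z ->
  (q %| perrin_seq n a b c - perrin_seq_mod q n a' b' c')%Z.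
Proof.
elim: n a b c a' b' c' => [|n IH] a b c a' b' c' //= ha hb hc; apply: IH => //.
rewrite -eqz_mod_dvd modz_mod eqz_mod_dvd.
have -> : a + b - (a' + b') = (a - a') + (b - b') by ring.
by rewrite rpredD.
Qed.

Lemma perrin_seq_mod_sub q n a b c d :
  (q %| perrin_seq_mod q n a b c - d)%Z = (q %| perrin_seq n a b c - d)%Z.
Proof.
have h : (q %| perrin_seq n a b c - perrin_seq_mod q n a b c)%Z.
  by apply: perrin_seq_modP; rewrite subrr dvdz0.
have -> : perrin_seq n a b c - d =
  (perrin_seq n a b c - perrin_seq_mod q n a b c) + (perrin_seq_mod q n a b c - d) by ring.
by rewrite [RHS]rpredDl.
Qed.

Definition periodic25 k a b c := (25 %| perrin_seq_mod 25 (k + 120) a b c - perrin_seq k a b c)%Z.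

Lemma periodic25_basis : all (fun k =>
  [&& periodic25 k 1 0 0, periodic25 k 0 1 0 & periodic25 k 0 0 1]) (iota 0 3).
Proof. by vm_compute. Qed.

(** The increments satisfy the recurrence, so three indices suffice; there they are linear in the
    initial values and are checked on the unit vectors. *)
Lemma perrin_like_period25 f x : perrin_like f -> (25 %| f (x + 120)%N - f x)%Z.
Proof.
move=> hf; have h k : (k < 3)%N -> (25 %| f (k + 120)%N - f k)%Z.
  move=> k3; have := allP periodic25_basis k; rewrite mem_iota => /(_ k3)/and3P[c0 c1 c2].
  have e a b c : periodic25 k a b c ->
     exists z, perrin_seq (k + 120) a b c = z * 25 + perrin_seq k a b c.
    by rewrite /periodic25 perrin_seq_mod_sub => /dvdzP[z e]; exists z; rewrite -e; ring.
  rewrite (perrin_likeE hf (k + 120)%N) (perrin_likeE hf k).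
  rewrite perrin_seq_linear [X in _ - X]perrin_seq_linear.
  have [z0 ->] := e _ _ _ c0; have [z1 ->] := e _ _ _ c1; have [z2 ->] := e _ _ _ c2.
  by apply/dvdzP; exists (f 0%N * z0 + f 1%N * z1 + f 2%N * z2); ring.
exact: (perrin_like_dvd (perrin_like_shift 120 hf) (h 0%N isT) (h 1%N isT) (h 2%N isT)).
Qed.

Lemma perrin_like_quotient d f : d != 0 -> perrin_like f -> (forall n, (d %| f n)%Z) ->
  exists2 g, perrin_like g & forall n, f n = d * g n.
Proof.
move=> d0 hf df; exists (fun n => (f n %/ d)%Z) => n; last by rewrite mulrC divzK.
by apply: (mulIf d0); rewrite mulrDl !divzK.
Qed.

(* The increment over [120 * 5^j] is exactly divisible by [5^(j+2)] as soon as
   the one over [120] is exactly divisible by [25]: summing five increments that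
   agree modulo 25 multiplies them by 5 up to a multiple of 25. *)
Lemma perrin_like_increment j f : perrin_like f ->
  exists2 g, perrin_like g & forall x,
    f (x + 120 * 5 ^ j)%N = f x + 5 ^+ j.+2 * g x /\
    (125 %| f (x + 120)%N - f x - 25 * g x)%Z.
Proof.
elim: j f => [|j IH] f hf.
  have [//|g hg E] := @perrin_like_quotient 25 _ _ (perrin_like_shift 120 hf) (fun x => perrin_like_period25 x hf).
  exists g => // x; rewrite expn0 muln1 E; split; last by rewrite subrr dvdz0.
  by have := E x; rewrite (_ : 5 ^+ 2 = 25) // => <-; ring.
have [g hg E] := IH f hf; have [g' hg' E'] := IH g hg.
pose h := (120 * 5 ^ j)%N.
have gh x i : exists z, g (x + i * h)%N = g x + 25 * z.
  elim: i => [|i [z ez]]; first by exists 0; rewrite addn0 mulr0 addr0.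
  rewrite mulSn [(h + _)%N]addnC addnA (E' _).1 ez exprS exprS.
  by exists (z + 5 ^+ j * g' (x + i * h)%N); ring.
have tele x : exists z, f (x + 120 * 5 ^ j.+1)%N = f x + 5 ^+ j.+3 * (g x + 5 * z).
  have e1 i : f (x + i.+1 * h)%N = f (x + i * h)%N + 5 ^+ j.+2 * g (x + i * h)%N.
    by rewrite -(E _).1 mulSn [(h + _)%N]addnC addnA.
  have [z1 g1] := gh x 1%N; have [z2 g2] := gh x 2%N.
  have [z3 g3] := gh x 3%N; have [z4 g4] := gh x 4%N.
  exists (z1 + z2 + z3 + z4); have -> : (120 * 5 ^ j.+1 = 5 * h)%N by rewrite expnS mulnCA.
  by rewrite !e1 mul0n addn0 g1 g2 g3 g4 [5 ^+ j.+3]exprS; ring.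
have [|||g1 hg1 E1] := @perrin_like_quotient (5 ^+ j.+3) (fun x => f (x + 120 * 5 ^ j.+1)%N - f x).
- by rewrite expf_neq0.
- exact: perrin_like_shift.
- by move=> x; have [z ->] := tele x; rewrite addrAC subrr add0r dvdz_mulr.
exists g1 => // x; split; first by rewrite -E1 addrC subrK.
have [z ez] := tele x; have := E1 x; rewrite ez addrAC subrr add0r.
move=> /(mulfI _) <-; last by rewrite expf_neq0.
have -> : f (x + 120)%N - f x - 25 * (g x + 5 * z) = (f (x + 120)%N - f x - 25 * g x) - 125 * z by ring.
by rewrite rpredB ?dvdz_mulr // (E x).2.
Qed.

(** Summing [a] increments gives [5^(j+2) (a g(0) + 5 z)], and the hypothesis modulo 125 says that 5
    does not divide [g(0)]. *)
Lemma perrin_like_multiple j f a : perrin_like f ->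
  ~~ (125 %| f 120%N - f 0%N)%Z -> ~~ (5 %| a)%N ->
  ~~ (5 ^+ j.+3 %| f (a * (120 * 5 ^ j))%N - f 0%N)%Z.
Proof.
move=> hf h125 a5; have [g hg E] := perrin_like_increment j hf.
have [g' _ E'] := perrin_like_increment j hg.
set h := (120 * 5 ^ j)%N in E E' *.
have gh i : exists z, g (i * h)%N = g 0%N + 5 * z.
  elim: i => [|i [z ez]]; first by exists 0; rewrite mulr0 addr0.
  rewrite mulSn [(h + _)%N]addnC (E' _).1 ez exprS.
  by exists (z + 5 ^+ j.+1 * g' (i * h)%N); ring.
have fh i : exists z, f (i * h)%N - f 0%N = 5 ^+ j.+2 * (i%:Z * g 0%N + 5 * z).
  elim: i => [|i [z ez]]; first by exists 0; rewrite mul0n subrr; ring.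
  have [z' ez'] := gh i; exists (z + z'); rewrite mulSn [(h + _)%N]addnC (E _).1 ez'.
  rewrite addrAC ez -[i.+1]addn1 PoszD; ring.
have [z ->] := fh a; rewrite [5 ^+ j.+3]exprSr dvdz_mul2l ?expf_neq0 //.
rewrite rpredDr; last exact: dvdz_mulr.
rewrite Gauss_dvdzr.
  apply: contra h125 => g5; have := (E 0%N).2; rewrite add0n => h25.
  rewrite -(subrK (25 * g 0%N) (f 120%N - f 0%N)) rpredD //.
  by rewrite (_ : 125 = 25 * 5) // dvdz_mul2l.
by rewrite coprimezE /= prime_coprime.
Qed.

(** If [5^e] exactly divides [t], then [t] is a multiple of [120 * 5^(e-1)] by a factor prime to 5,
    so [5^(e+2)] does not divide the increment; hence [l <= e + 1]. *)
Lemma perrin_like_5adic f t l : perrin_like f ->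
  ~~ (125 %| f 120%N - f 0%N)%Z -> (0 < t)%N -> (120 %| t)%N ->
  (5 ^+ l %| f t - f 0%N)%Z -> (5 ^ (l - 1) %| t)%N.
Proof.
move=> hf h125 t0 t120 hl; have [b b5 tE] := pfactor_coprime (isT : prime 5) t0.
have e0 : (0 < logn 5 t)%N.
  by rewrite logn_gt0 mem_primes t0 /= (dvdn_trans _ t120).
rewrite pfactor_dvdn // leqNgt; apply/negP => lt.
have b24 : (24 %| b)%N.
  have : (24 %| t)%N by apply: dvdn_trans t120.
  by rewrite tE Gauss_dvdl // coprimeXr.
have tE' : t = (b %/ 24 * (120 * 5 ^ (logn 5 t).-1))%N.
  have -> : (120 * 5 ^ (logn 5 t).-1 = 24 * 5 ^ logn 5 t)%N.
    by rewrite -{2}(prednK e0) expnS; lia.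
  by rewrite mulnA divnK.
have a5 : ~~ (5 %| b %/ 24)%N.
  apply: contraL (b5) => h; rewrite -(divnK b24) prime_coprime // negbK.
  exact: dvdn_mulr.
have := perrin_like_multiple (logn 5 t).-1 hf h125 a5; rewrite -tE' => /negP; apply.
apply: dvdz_trans hl; rewrite dvdz_exp2l //; lia.
Qed.

Lemma perrin_int_like : perrin_like (fun n => (perrin n)%:Z).
Proof. by move=> n; rewrite -PoszD. Qed.

(* [P_(-nu) = -1] for these four values of [nu]; the triples are
   [(nu, P_(1-nu), P_(2-nu))]. *)
Definition minus_one_indices : seq (nat * int * int) :=
  [:: (1%N, 3, 0); (7%N, -2, 4); (11%N, 6, -7); (29%N, 67, -88)].

Lemma minus_one_check : all (fun v => let: (nu, b, c) := v in
  [&& perrin_seq nu (-1) b c == 3, perrin_seq nu.+1 (-1) b c == 0, perrin_seq nu.+2 (-1) b c == 2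
    & ~~ (125 %| perrin_seq_mod 125 120 (-1) b c - (-1))%Z]) minus_one_indices.
Proof. by vm_compute. Qed.

Lemma perrin_seq_dvd_sub q k a b c : ~~ (q %| perrin_seq_mod q k a b c - a)%Z ->
  ~~ (q %| perrin_seq k a b c - perrin_seq 0 a b c)%Z.
Proof. by rewrite perrin_seq_mod_sub. Qed.

Lemma perrin_like_exists a b c k q : ~~ (q %| perrin_seq_mod q k a b c - a)%Z ->
  exists V, [/\ perrin_like V, forall n, V n = perrin_seq n a b c & ~~ (q %| V k - V 0%N)%Z].
Proof.
move=> h; exists (fun n => perrin_seq n a b c); split=> //; first exact: perrin_seq_like.
exact: perrin_seq_dvd_sub.
Qed.

(** [V] is the Perrin sequence started [nu] indices earlier, so [V 0 = -1] and [P_n + 1] is the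
    increment of [V] from [0] to [n + nu]. *)
Lemma perrin_minus_one_5adic v n l : v \in minus_one_indices -> (120 %| n + v.1.1)%N ->
  (5 ^ l %| perrin n + 1)%N -> (5 ^ (l - 1) %| n + v.1.1)%N.
Proof.
case: v => [[nu b] c] hv h120 h5; have := allP minus_one_check _ hv.
move=> /and4P[/eqP e0 /eqP e1 /eqP e2 /perrin_like_exists[V [hV VE V125]]].
have nu0 : (0 < nu)%N by case: nu hv {e0 e1 e2 h120 h5}.
have VP : (fun k => V (k + nu)%N) =1 (fun k => (perrin k)%:Z).
  apply: perrin_like_ext; [by move=> k; rewrite !addSn hV | exact: perrin_int_like | | |].
  - by rewrite VE e0.
  - by rewrite VE e1.
  - by rewrite VE e2.
apply: (perrin_like_5adic hV V125 _ h120); first by rewrite addn_gt0 nu0 orbT.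
by rewrite VP VE opprK -PoszD dvdzE abszX.
Qed.

(** * Sieving by congruences *)

Lemma N_of_natD a b : N.of_nat (a + b) = N.add (N.of_nat a) (N.of_nat b).
Proof. by lia. Qed.
Lemma N_of_natM a b : N.of_nat (a * b) = N.mul (N.of_nat a) (N.of_nat b).
Proof. by lia. Qed.
Lemma N_of_nat_mod a q : N.of_nat (a %% q) = N.modulo (N.of_nat a) (N.of_nat q).
Proof.
have [->|q0] := posnP q; first by rewrite modn0; case: (N.of_nat a).
apply: (N.mod_unique _ _ (N.of_nat (a %/ q))); first by have := ltn_pmod a q0; lia.
by rewrite -N_of_natM -N_of_natD mulnC -divn_eq.
Qed.
Lemma N_of_nat_exp a k : N.of_nat (a ^ k) = N.pow (N.of_nat a) (N.of_nat k).
Proof.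
elim: k => // k IH; rewrite expnS N_of_natM IH Nat2N.inj_succ N.pow_succ_r' //.
Qed.
Lemma N_of_nat_eqb a b : N.eqb (N.of_nat a) (N.of_nat b) = (a == b).
Proof. by lia. Qed.

Lemma modzDMl m d z : (m + d * z = m %[mod d])%Z.
Proof. by rewrite addrC mulrC modzMDl. Qed.

Definition N_to_int (x : N) : int := (N.to_nat x)%:Z.

Lemma N_to_intD x y : N_to_int (N.add x y) = N_to_int x + N_to_int y.
Proof. by rewrite /N_to_int; lia. Qed.
Lemma N_to_intM x y : N_to_int (N.mul x y) = N_to_int x * N_to_int y.
Proof. by rewrite /N_to_int N2Nat.inj_mul -PoszM. Qed.
Lemma N_to_int_mod x q : exists z, N_to_int (N.modulo x q) = N_to_int x + N_to_int q * z.
Proof.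
exists (- N_to_int (N.div x q)); rewrite {2}(N.div_mod' x q) N_to_intD N_to_intM; ring.
Qed.

(** * Perrin numbers modulo [q] *)

Section FastPerrin.
Variable q : N.

(* Since [x^3 = x + 1], if [x^n = u + v x + w x^2] modulo [q] then
   [P_(n+k) = u P_k + v P_(k+1) + w P_(k+2)] modulo [q]; a triple [(u, v, w)]
   stands for such a power of [x]. *)
Definition shift_mul (s t : N * N * N) : N * N * N :=
  let: (u, v, w) := s in let: (u', v', w') := t in
  let vw := N.add (N.mul v w') (N.mul w v') in
  let ww := N.mul w w' in
  (N.modulo (N.add (N.mul u u') vw) q,
   N.modulo (N.add (N.add (N.mul u v') (N.mul v u')) (N.add vw ww)) q,
   N.modulo (N.add (N.add (N.mul u w') (N.mul w u')) (N.add (N.mul v v') ww)) q).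

Fixpoint shift_pow (p : positive) : N * N * N :=
  match p with
  | xH => (0%num, 1%num, 0%num)
  | xO p' => let s := shift_pow p' in shift_mul s s
  | xI p' => let s := shift_pow p' in shift_mul (shift_mul s s) (0%num, 1%num, 0%num)
  end.

Let perrinZ n : int := (perrin n)%:Z.
Definition is_shift n (s : N * N * N) := forall k, exists z,
  perrinZ (n + k) = N_to_int s.1.1 * perrinZ k + N_to_int s.1.2 * perrinZ k.+1
                    + N_to_int s.2 * perrinZ k.+2 + N_to_int q * z.

Let perrinZS n : perrinZ n.+3 = perrinZ n.+1 + perrinZ n.
Proof. by rewrite /perrinZ -PoszD. Qed.

Lemma is_shift_mul n n' s t : is_shift n s -> is_shift n' t -> is_shift (n + n') (shift_mul s t).
Proof.
case: s t => [[u v] w] [[u' v'] w'] hs ht k /=.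
have [z ez] := hs (n' + k)%N; have [z0 e0] := ht k; have [z1 e1] := ht k.+1; have [z2 e2] := ht k.+2.
move: ez e0 e1 e2; rewrite /= !addnS !perrinZS => ez e0 e1 e2.
have [y0 f0] := N_to_int_mod (N.add (N.mul u u') (N.add (N.mul v w') (N.mul w v'))) q.
have [y1 f1] := N_to_int_mod (N.add (N.add (N.mul u v') (N.mul v u')) (N.add (N.add (N.mul v w') (N.mul w v')) (N.mul w w'))) q.
have [y2 f2] := N_to_int_mod (N.add (N.add (N.mul u w') (N.mul w u')) (N.add (N.mul v v') (N.mul w w'))) q.
rewrite f0 f1 f2 -addnA ez e0 e1 e2 !N_to_intD !N_to_intM.
exists (z + N_to_int u * z0 + N_to_int v * z1 + N_to_int w * z2
  - y0 * perrinZ k - y1 * perrinZ k.+1 - y2 * perrinZ k.+2). ring.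
Qed.

Lemma is_shift1 : is_shift 1 (0%num, 1%num, 0%num).
Proof. move=> k; exists 0; rewrite add1n /=.
have -> : N_to_int 1%num = 1 by []; have -> : N_to_int 0%num = 0 by []; ring. Qed.

Lemma shift_powP p : is_shift (Pos.to_nat p) (shift_pow p).
Proof.
elim: p => [p IH|p IH|]; last exact: is_shift1.
- have -> : Pos.to_nat p~1 = (Pos.to_nat p + Pos.to_nat p + 1)%N by lia.
  exact: (is_shift_mul (is_shift_mul IH IH) is_shift1).
- have -> : Pos.to_nat p~0 = (Pos.to_nat p + Pos.to_nat p)%N by lia.
  exact: (is_shift_mul IH IH).
Qed.

Lemma perrin_periodic p n : shift_pow p = (1%num, 0%num, 0%num) ->
  perrin n = perrin (n %% Pos.to_nat p) %[mod N.to_nat q].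
Proof.
move=> hp; rewrite {1}(divn_eq n (Pos.to_nat p)) addnC.
elim: (n %/ _)%N => [|k IH]; first by rewrite addn0.
rewrite mulSn addnCA -IH {IH}; have [z] := shift_powP p (n %% Pos.to_nat p + k * Pos.to_nat p)%N.
rewrite hp /perrinZ /= => e.
apply/eqP; rewrite -eqz_nat -!modz_nat; apply/eqP; rewrite e.
have -> : N_to_int 1%num = 1 by []; have -> : N_to_int 0%num = 0 by [].
by rewrite mul1r !mul0r !addr0 modzDMl.
Qed.

(** The shift relation at [k = 0], with [P_0 = 3], [P_1 = 0], [P_2 = 2]. *)
Definition perrin_N (p : positive) : N :=
  let: (u, v, w) := shift_pow p in N.modulo (N.add (N.mul 3 u) (N.mul 2 w)) q.

Lemma perrin_value p : perrin (Pos.to_nat p) = N.to_nat (perrin_N p) %[mod N.to_nat q].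
Proof.
rewrite /perrin_N; have [z] := shift_powP p 0; case: (shift_pow p) => [[u v] w] /= e.
apply/eqP; rewrite -eqz_nat -!modz_nat; apply/eqP.
have [y ey] := N_to_int_mod (N.add (N.mul 3 u) (N.mul 2 w)) q.
rewrite -[X in (_ = X %% _)%Z]/(N_to_int _) ey !N_to_intD !N_to_intM.
move: e; rewrite /perrinZ addn0 => ->; rewrite !modzDMl.
have -> : N_to_int 2%num = 2 by []; have -> : N_to_int 3%num = 3 by [].
by congr (_ %% _)%Z; rewrite /=; ring.
Qed.

End FastPerrin.

Section Scan.
Variables (q : N) (f : N -> N -> bool).

Fixpoint perrin_scan (k : nat) (n a b c : N) : bool :=
  if k is k'.+1 then
    if f n a then perrin_scan k' (N.succ n) b c (N.modulo (N.add a b) q) else false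
  else true.

Lemma perrin_scanP k n :
  perrin_scan k (N.of_nat n) (N.of_nat (perrin n %% N.to_nat q))
    (N.of_nat (perrin n.+1 %% N.to_nat q)) (N.of_nat (perrin n.+2 %% N.to_nat q)) ->
  forall i, (i < k)%N -> f (N.of_nat (n + i)) (N.of_nat (perrin (n + i) %% N.to_nat q)).
Proof.
elim: k n => // k IH n /=; case: ifP => // fn; rewrite -Nat2N.inj_succ.
have -> : N.modulo (N.add (N.of_nat (perrin n %% N.to_nat q)) (N.of_nat (perrin n.+1 %% N.to_nat q))) q
   = N.of_nat (perrin n.+3 %% N.to_nat q).
  by rewrite -{3}(N2Nat.id q) -N_of_natD -N_of_nat_mod modnDm addnC.
by move=> /IH h [|i] ik; rewrite ?addn0 // addnS -addSn; apply: h.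
Qed.
End Scan.

(** Here [a], [x], [y] stand for residues of [P_n], [10^l], [10^m]. *)
Definition palindrome_mod (q a x y d1 d2 : N) : bool :=
  let xy := N.mul x y in
  N.eqb (N.modulo (N.add (N.add (N.add (N.mul 9 a) (N.mul d1 xy)) (N.mul d2 x)) d1) q)
        (N.modulo (N.add (N.add (N.mul d1 (N.mul x xy)) (N.mul d2 xy)) (N.mul d1 x)) q).

(* The closed form of the concatenation with all subtractions moved across. *)
Definition palindrome_eq (P l m d1 d2 : nat) : Prop :=
  (9 * P + d1 * (10 ^ l * 10 ^ m) + d2 * 10 ^ l + d1 =
   d1 * (10 ^ l * (10 ^ l * 10 ^ m)) + d2 * (10 ^ l * 10 ^ m) + d1 * 10 ^ l)%N.

Lemma palindrome_modE q a x y d1 d2 :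
  palindrome_mod (N.of_nat q) (N.of_nat a) (N.of_nat x) (N.of_nat y) (N.of_nat d1) (N.of_nat d2) =
  ((9 * a + d1 * (x * y) + d2 * x + d1) %% q ==
   (d1 * (x * (x * y)) + d2 * (x * y) + d1 * x) %% q)%N.
Proof.
rewrite /palindrome_mod -[9%num]/(N.of_nat 9).
by rewrite -!N_of_natM -!N_of_natD -!N_of_nat_mod N_of_nat_eqb.
Qed.

Lemma palindrome_eq_mod (q a x y : N) P l m d1 d2 : palindrome_eq P l m d1 d2 ->
  (P = N.to_nat a %[mod N.to_nat q])%N -> (10 ^ l = N.to_nat x %[mod N.to_nat q])%N ->
  (10 ^ m = N.to_nat y %[mod N.to_nat q])%N ->
  palindrome_mod q a x y (N.of_nat d1) (N.of_nat d2).
Proof.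
move=> E Pa ll mm; rewrite -(N2Nat.id q) -(N2Nat.id a) -(N2Nat.id x) -(N2Nat.id y) palindrome_modE.
move: Pa ll mm E.
move: (N.to_nat q) (N.to_nat a) (N.to_nat x) (N.to_nat y) => {}q {}a {}x {}y.
move=> Pa ll mm E; apply/eqP; move: E; rewrite /palindrome_eq.
have M u v u' v' : (u = u' %[mod q] -> v = v' %[mod q] -> u * v = u' * v' %[mod q])%N.
  by move=> e1 e2; rewrite -modnMm e1 e2 modnMm.
have D u v u' v' : (u = u' %[mod q] -> v = v' %[mod q] -> u + v = u' + v' %[mod q])%N.
  by move=> e1 e2; rewrite -modnDm e1 e2 modnDm.
have L1 : (9 * P + d1 * (10 ^ l * 10 ^ m) + d2 * 10 ^ l + d1 =
    9 * a + d1 * (x * y) + d2 * x + d1 %[mod q])%N.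
  by repeat first [assumption | reflexivity | apply D | apply M].
have L2 : (d1 * (10 ^ l * (10 ^ l * 10 ^ m)) + d2 * (10 ^ l * 10 ^ m) + d1 * 10 ^ l =
    d1 * (x * (x * y)) + d2 * (x * y) + d1 * x %[mod q])%N.
  by repeat first [assumption | reflexivity | apply D | apply M].
by move=> E; rewrite -L1 -L2 E.
Qed.

Lemma exp_mod_period b q t l : (b ^ t = 1 %[mod q])%N -> (b ^ l = b ^ (l %% t) %[mod q])%N.
Proof.
move=> h; have e : (b ^ (l %/ t * t) = 1 %[mod q])%N.
  by rewrite mulnC expnM -modnXm h modnXm exp1n.
by rewrite {1}(divn_eq l t) expnD -modnMml e modnMml mul1n.
Qed.

Lemma decimal_value_nseq (d : 'I_10) k a :
  (9 * foldl (fun (a : nat) (d : 'I_10) => 10 * a + d) a (nseq k d) + d = (9 * a + d) * 10 ^ k)%N.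
Proof.
elim: k a => [|k IH] a /=; first by rewrite muln1.
by rewrite IH expnS; ring.
Qed.

Lemma palindromic_concatenationP l m (d1 d2 : 'I_10) :
  palindrome_eq (decimal_value (nseq l d1 ++ nseq m d2 ++ nseq l d1)) l m d1 d2.
Proof.
rewrite /decimal_value !foldl_cat /palindrome_eq.
set F := foldl _; set a := F 0%N _; set b := F a _; set c := F b _.
have ha : (9 * a + d1 = d1 * 10 ^ l)%N by rewrite decimal_value_nseq muln0.
have hb : (9 * b + d2 = (9 * a + d2) * 10 ^ m)%N by rewrite decimal_value_nseq.
have hc : (9 * c + d1 = (9 * b + d1) * 10 ^ l)%N by rewrite decimal_value_nseq.
move: ha hb hc; move: a b c (10 ^ l)%N (10 ^ m)%N (nat_of_ord d1) (nat_of_ord d2) => {F} a b c x y e f ha hb hc.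
have : ((9 * b + f) * x + e * x = ((9 * a + f) * y) * x + e * x)%N by rewrite hb.
have : ((9 * a + e) * (y * x) = e * x * (y * x))%N by rewrite ha.
nia.
Qed.

Definition rangeN k : seq N := [seq N.of_nat i | i <- iota 0 k].

Lemma rangeNP k (p : N -> bool) : all p (rangeN k) -> forall i, (i < k)%N -> p (N.of_nat i).
Proof. by move/allP => h i ik; apply: h; rewrite map_f // mem_iota. Qed.

Fixpoint pow10_mod_pos (q : N) (p : positive) : N :=
  match p with
  | xH => N.modulo 10 q
  | xO p' => let s := pow10_mod_pos q p' in N.modulo (N.mul s s) q
  | xI p' => let s := pow10_mod_pos q p' in N.modulo (N.mul 10 (N.mul s s)) q
  end.

Definition pow10_mod (q k : N) : N :=
  if k is Npos p then pow10_mod_pos q p else N.modulo 1 q.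

Lemma pow10_modE q k : pow10_mod q k = N.modulo (N.pow 10 k) q.
Proof.
case: k => // p; rewrite /pow10_mod; elim: p => [p IH|p IH|//]; cbn [pow10_mod_pos]; rewrite IH.
- have -> : N.pow 10 (Npos p~1) = N.mul 10 (N.mul (N.pow 10 (Npos p)) (N.pow 10 (Npos p))).
    by rewrite -N.pow_add_r -N.pow_succ_r'; congr N.pow; lia.
  move: (N.pow 10 (Npos p)) => x; rewrite (N.Div0.mul_mod 10 (N.mul (N.modulo x q) _) q).
  by rewrite -(N.Div0.mul_mod x x q) -(N.Div0.mul_mod 10 (N.mul x x) q).
- have -> : N.pow 10 (Npos p~0) = N.mul (N.pow 10 (Npos p)) (N.pow 10 (Npos p)).
    by rewrite -N.pow_add_r; congr N.pow; lia.
  by rewrite -N.Div0.mul_mod.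
Qed.

(** * The sieve over one period of length 21000 *)

Definition palindrome_exp q a l m d1 d2 :=
  palindrome_mod q a (pow10_mod q l) (pow10_mod q m) d1 d2.

(* [10^4 * 11 * 101 * 211]: the Perrin sequence has period 21000 modulo this
   number, and 10 has order 4 modulo 1111 and 30 modulo 211. *)
Definition sieve_modulus : N := 2344210000.

(* Classes of [(l, m)] modulo 60. *)
Definition minus_one_classes : seq (N * N) := [:: (59, 1); (3, 37); (15, 29); (55, 53)]%num.

(* [a] is [P_n] modulo [sieve_modulus]; the cases are [l >= 4], then [l <= 3] and
   [l + m >= 4], then [l + m <= 3] where [a] is [P_n] itself. *)
Definition sieve_long (n a d1 : N) : bool :=
  if N.eqb (N.modulo (N.add (N.mul 9 a) d1) 10000) 0 then
    all (fun d2 => all (fun l => all (fun m =>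
      if palindrome_exp 1111 a l m d1 d2 then
        all (fun i => all (fun j =>
          let l' := N.add l (N.mul 4 i) in let m' := N.add m (N.mul 4 j) in
          if palindrome_exp 211 a l' m' d1 d2 then
            [&& N.eqb d1 9, N.eqb d2 8, n \in [:: 20971; 20989; 20993; 20999]%num
              & (l', m') \in minus_one_classes]
          else true) (rangeN 15)) (rangeN 15)
      else true) (rangeN 4)) (rangeN 4)) (rangeN 10)
  else true.

(** Since [l + m >= 4], the multiples of [10^(l+m)] vanish modulo 10000, which leaves
    [9 P_n + d2 * 10^l + d1 = d1 * 10^l]. The test modulo [10^l] comes before the loop over [d2]. *)
Definition sieve_short (n a d1 : N) : bool :=
  let b := N.modulo (N.add (N.mul 9 a) d1) 10000 in
  all (fun l =>
    let x := N.pow 10 l in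
    if N.eqb (N.modulo b x) 0 then
      let c := N.modulo (N.mul d1 x) 10000 in
      all (fun d2 =>
        if N.eqb (N.modulo (N.add b (N.mul d2 x)) 10000) c then
          all (fun m =>
            if palindrome_exp 1111 a l m d1 d2 then
              all (fun j => if palindrome_exp 211 a l (N.add m (N.mul 4 j)) d1 d2 then
                [&& N.eqb n 10171, N.eqb l 3, N.eqb d1 9 & N.eqb d2 8] else true) (rangeN 15)
            else true) (rangeN 4)
        else true) (rangeN 10)
    else true) [:: 1; 2; 3]%num.

(** A number of at most six digits or so lies below 2000000. Small residues also occur near the end
    of the period, which corresponds to negative indices; for these only [20000 <= n] is recorded,
    and the growth of [P_n] excludes them later. *)
Definition sieve_tiny (n a d1 : N) : bool :=
  if N.ltb a 2000000 then
    all (fun d2 => all (fun l => all (fun m =>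
      if palindrome_exp sieve_modulus a l m d1 d2 then
        if N.eqb a 22 then true else if N.ltb a 1000 then N.leb 20000 n else ~~ N.leb (N.add l m) 3
      else true) (rangeN 3)) [:: 1; 2; 3]%num) (rangeN 10)
  else true.

(** As [l >= 1], the digit [d1] is the last digit of [P_n] and need not be searched for. *)
Definition sieve (n a : N) : bool :=
  let d1 := N.modulo a 10 in
  if N.eqb d1 0 then true else [&& sieve_long n a d1, sieve_short n a d1 & sieve_tiny n a d1].

Lemma sieve_check : perrin_scan sieve_modulus sieve (21 * 1000) 0 3 0 2.
Proof. by vm_compute. Qed.

Lemma N_to_nat_exp10 k : N.to_nat (N.pow 10 (N.of_nat k)) = (10 ^ k)%N.
Proof. by rewrite -[10%num]/(N.of_nat 10) -N_of_nat_exp Nat2N.id. Qed.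

Lemma eqn_mod_to_N a (b r : N) : N.modulo (N.of_nat a) r = N.modulo b r ->
  a = N.to_nat b %[mod N.to_nat r].
Proof.
move=> h; apply: Nat2N.inj.
by rewrite !N_of_nat_mod !N2Nat.id h.
Qed.

Lemma exp10_mod k (r : N) :
  10 ^ k = N.to_nat (pow10_mod r (N.of_nat k)) %[mod N.to_nat r].
Proof.
by rewrite pow10_modE; apply: eqn_mod_to_N; rewrite N_of_nat_exp N.Div0.mod_mod.
Qed.

Lemma exp10_eq1 t (r : N) : pow10_mod r (N.of_nat t) = N.modulo 1 r ->
  10 ^ t = 1 %[mod N.to_nat r].
Proof.
rewrite pow10_modE -N_to_nat_exp10 => h.
by apply: (@eqn_mod_to_N _ 1); rewrite -h N_to_nat_exp10 N_of_nat_exp.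
Qed.

Lemma palindrome_expP t (r a : N) P l m d1 d2 : palindrome_eq P l m d1 d2 ->
  (P = N.to_nat a %[mod N.to_nat r])%N ->
  pow10_mod r (N.of_nat t) = N.modulo 1 r ->
  palindrome_exp r a (N.of_nat (l %% t)) (N.of_nat (m %% t)) (N.of_nat d1) (N.of_nat d2).
Proof.
move=> E Pa /exp10_eq1 ht; apply: palindrome_eq_mod E Pa _ _; rewrite -exp10_mod;
  exact: exp_mod_period.
Qed.

Lemma sieveP n (L := Pos.to_nat 21000) :
  sieve (N.of_nat (n %% L)) (N.of_nat (perrin (n %% L) %% N.to_nat sieve_modulus)).
Proof.
have nL : (n %% L < 21 * 1000)%N.
  by apply: leq_trans (ltn_pmod _ _) _; rewrite /L; lia.
have q3 : (3 < N.to_nat sieve_modulus)%N by rewrite /sieve_modulus; lia.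
have small k : (k <= 3)%N -> N.of_nat (k %% N.to_nat sieve_modulus) = N.of_nat k.
  by move=> k3; rewrite modn_small // (leq_ltn_trans k3).
have := @perrin_scanP sieve_modulus sieve (21 * 1000) 0.
rewrite (small (perrin 0)) // (small (perrin 1)) // (small (perrin 2)) //.
by move=> /(_ sieve_check _ nL); rewrite add0n.
Qed.

Section Sieve.
Variables (n l m d1 d2 : nat).
Hypotheses (E : palindrome_eq (perrin n) l m d1 d2).
Hypotheses (l_gt0 : (0 < l)%N) (d1_gt0 : (0 < d1)%N) (d1_lt : (d1 < 10)%N) (d2_lt : (d2 < 10)%N).
Let L := Pos.to_nat 21000.
Let a := (perrin (n %% L) %% N.to_nat sieve_modulus)%N.

Let period_a r : N.modulo sieve_modulus r = 0%num -> (perrin n = N.to_nat (N.of_nat a) %[mod N.to_nat r])%N.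
Proof.
move=> rq; rewrite Nat2N.id /a.
have h : (N.to_nat r %| N.to_nat sieve_modulus)%N.
  by rewrite /dvdn; apply/eqP; apply: Nat2N.inj; rewrite N_of_nat_mod !N2Nat.id rq.
have hp : shift_pow sieve_modulus 21000 = (1%num, 0%num, 0%num) by vm_compute.
by rewrite -(modn_dvdm (perrin n) h) (perrin_periodic n hp).
Qed.

Let palindrome_class r t (rq : N.modulo sieve_modulus r = 0%num)
    (ht : pow10_mod r (N.of_nat t) = N.modulo 1 r) :=
  palindrome_expP E (period_a rq) ht.

Let last_digit : N.modulo (N.of_nat a) 10 = N.of_nat d1.
Proof.
have h : (perrin n %% 10 = d1)%N.
  move: E; rewrite /palindrome_eq -(prednK l_gt0) expnS.
  move: (10 ^ l.-1)%N (10 ^ m)%N (perrin n) => x y p; clear -d1_lt; nia.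
have := period_a (erefl : N.modulo sieve_modulus 10 = 0%num); rewrite Nat2N.id h => e.
by rewrite [in RHS]e -[10%num]/(N.of_nat 10) -N_of_nat_mod.
Qed.

Let sieved : [&& sieve_long (N.of_nat (n %% L)) (N.of_nat a) (N.of_nat d1),
  sieve_short (N.of_nat (n %% L)) (N.of_nat a) (N.of_nat d1) &
  sieve_tiny (N.of_nat (n %% L)) (N.of_nat a) (N.of_nat d1)].
Proof.
have := sieveP n; rewrite -/L -/a /sieve last_digit.
by rewrite -[0%num]/(N.of_nat 0) N_of_nat_eqb (gtn_eqF d1_gt0).
Qed.

Lemma sieve_long_classes : (4 <= l)%N ->
  [/\ d1 = 9%N, d2 = 8%N, exists2 v, v \in minus_one_indices & (L %| n + v.1.1)%N
    & [\/ l %% 60 = 59 /\ m %% 60 = 1, l %% 60 = 3 /\ m %% 60 = 37,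
          l %% 60 = 15 /\ m %% 60 = 29 | l %% 60 = 55 /\ m %% 60 = 53]%N].
Proof.
move=> l4; have /and3P[h _ _] := sieved; move: h; rewrite /sieve_long.
have -> : N.eqb (N.modulo (N.add (N.mul 9 (N.of_nat a)) (N.of_nat d1)) 10000) 0.
  have e4 : N.to_nat 10000 = (10 ^ 4)%N by lia.
  have h0 : (10 ^ l = N.to_nat 0 %[mod N.to_nat 10000])%N.
    by rewrite e4 -(subnKC l4) expnD modnMr mod0n.
  have hm : (10 ^ m = N.to_nat (N.of_nat (10 ^ m)) %[mod N.to_nat 10000])%N by rewrite Nat2N.id.
  have := palindrome_eq_mod E (period_a (erefl : N.modulo sieve_modulus 10000 = 0%num)) h0 hm.
  by rewrite /palindrome_mod !N.mul_0_l !N.mul_0_r !N.add_0_r.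
have m4 k : (k %% 4 < 4)%N by rewrite ltn_pmod.
move=> /rangeNP/(_ _ d2_lt) /rangeNP/(_ _ (m4 l)) /rangeNP/(_ _ (m4 m)).
rewrite (@palindrome_class 1111 4 erefl erefl).
have r15 k : (k %% 60 %/ 4 < 15)%N by rewrite ltn_divLR // ltn_pmod.
move=> /rangeNP/(_ _ (r15 l)) /rangeNP/(_ _ (r15 m)).
have k60 k : N.add (N.of_nat (k %% 4)) (N.mul 4 (N.of_nat (k %% 60 %/ 4))) = N.of_nat (k %% 60) by lia.
rewrite !k60 (@palindrome_class 211 60 erefl erefl).
case/and4P; rewrite -[9%num]/(N.of_nat 9) -[8%num]/(N.of_nat 8) !N_of_nat_eqb => /eqP -> /eqP -> hn hc.
split=> //.
- have dv nu (r : N) : N.of_nat (n %% L) = r -> N.add r (N.of_nat nu) = 21000%num -> (L %| n + nu)%N.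
    by move=> hr hnu; rewrite /dvdn -modnDml (_ : n %% L + nu = L)%N ?modnn // /L; lia.
  move: hn; rewrite !inE => /or4P[] /eqP /dv.
  + by move=> /(_ 29%N erefl); exists (29%N, 67, -88).
  + by move=> /(_ 11%N erefl); exists (11%N, 6, -7).
  + by move=> /(_ 7%N erefl); exists (7%N, -2, 4).
  + by move=> /(_ 1%N erefl); exists (1%N, 3, 0).
- move: hc; rewrite !inE !xpair_eqE => /or4P[] /andP[/eqP h1 /eqP h2].
  + by apply: Or41; lia.
  + by apply: Or42; lia.
  + by apply: Or43; lia.
  + by apply: Or44; lia.
Qed.

Lemma sieve_short_class : (l <= 3)%N -> (4 <= l + m)%N ->
  [/\ d1 = 9%N, d2 = 8%N, l = 3%N & (n %% L = Pos.to_nat 10171)%N].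
Proof.
move=> l3 lm4; have /and3P[_ h _] := sieved; move: h; rewrite /sieve_short.
have l13 : N.of_nat l \in [:: 1; 2; 3]%num.
  by move: l_gt0 l3; case: (l) => [|[|[|[|]]]].
move=> /allP/(_ _ l13).
have aP : (a = perrin n %[mod 10 ^ 4])%N.
  have e4 : N.to_nat 10000 = (10 ^ 4)%N by lia.
  by rewrite -e4 (period_a (erefl : N.modulo sieve_modulus 10000 = 0%num)) Nat2N.id.
have e10 : 10000%num = N.of_nat (10 ^ 4) by lia.
have lin : (9 * a + d1 = 9 * perrin n + d1 %[mod 10 ^ 4])%N.
  by rewrite -modnDml -modnMmr aP modnMmr modnDml.
have modD A u v w R : (A + R * u = w + R * v)%N -> (A = w %[mod R])%N.
  by move=> e; rewrite -(modnMDl u A R) mulnC addnC e addnC mulnC modnMDl.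
have c1 : (((9 * a + d1) %% 10 ^ 4) %% 10 ^ l = 0)%N.
  rewrite lin modn_dvdm ?dvdn_exp2l ?(leq_trans l3) // -[RHS](mod0n (10 ^ l)).
  apply: (modD _ (d1 * 10 ^ m + d2)%N (d1 * (10 ^ l * 10 ^ m) + d2 * 10 ^ m + d1)%N).
  by move: E; rewrite /palindrome_eq; move: (10 ^ l)%N (10 ^ m)%N (perrin n) => x y p; clear; nia.
have c2 : ((9 * a + d1) %% 10 ^ 4 + d2 * 10 ^ l = d1 * 10 ^ l %[mod 10 ^ 4])%N.
  rewrite lin modnDml.
  have xy : (10 ^ l * 10 ^ m = 10 ^ 4 * 10 ^ (l + m - 4))%N by rewrite -!expnD subnKC.
  apply: (modD _ (d1 * 10 ^ (l + m - 4))%N ((d1 * 10 ^ l + d2) * 10 ^ (l + m - 4))%N).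
  move: E; rewrite /palindrome_eq xy; move: (10 ^ (l + m - 4))%N (10 ^ l)%N (10 ^ 4)%N (perrin n) => t x R p.
  by clear; nia.
rewrite -[9%num]/(N.of_nat 9) -[10%num]/(N.of_nat 10) e10 -N_of_nat_exp -!N_of_natM -!N_of_natD -!N_of_nat_mod.
rewrite -[0%num]/(N.of_nat 0) N_of_nat_eqb c1 eqxx => /rangeNP/(_ _ d2_lt).
rewrite -!N_of_natM -!N_of_natD -!N_of_nat_mod N_of_nat_eqb c2 eqxx.
have m4 k : (k %% 4 < 4)%N by rewrite ltn_pmod.
have r15 k : (k %% 60 %/ 4 < 15)%N by rewrite ltn_divLR // ltn_pmod.
have k60 k : N.add (N.of_nat (k %% 4)) (N.mul 4 (N.of_nat (k %% 60 %/ 4))) = N.of_nat (k %% 60) by lia.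
have l4 : (l %% 4 = l)%N by rewrite modn_small.
have l60 : (l %% 60 = l)%N by rewrite modn_small // (leq_ltn_trans l3).
move=> /rangeNP/(_ _ (m4 m)); have := @palindrome_class 1111 4 erefl erefl; rewrite l4 => ->.
move=> /rangeNP/(_ _ (r15 m)); rewrite k60; have := @palindrome_class 211 60 erefl erefl; rewrite l60 => ->.
by case/and4P => /N.eqb_eq h1 /N.eqb_eq h2 /N.eqb_eq h3 /N.eqb_eq h4; split; lia.
Qed.

Lemma sieve_tiny_value : (l <= 3)%N -> (l + m <= 3)%N -> perrin n = 22%N.
Proof.
move=> l3 lm3; have /and3P[_ _ h] := sieved; move: h; rewrite /sieve_tiny.
have Psmall : (perrin n < N.to_nat 2000000)%N.
  have xy : (10 ^ l * 10 ^ m <= 10 ^ 3)%N by rewrite -expnD leq_pexp2l.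
  have x3 : (10 ^ l <= 10 ^ 3)%N by rewrite leq_pexp2l.
  have xxy := leq_mul x3 xy; have f1 := leq_mul (ltnW d1_lt) xxy.
  have f2 := leq_mul (ltnW d2_lt) xy; have f3 := leq_mul (ltnW d1_lt) x3.
  move: E; rewrite /palindrome_eq => E'.
  have : (9 * perrin n <= 10 * (10 ^ 3 * 10 ^ 3) + 10 * 10 ^ 3 + 10 * 10 ^ 3)%N.
    apply: (@leq_trans (d1 * (10 ^ l * (10 ^ l * 10 ^ m)) + d2 * (10 ^ l * 10 ^ m) + d1 * 10 ^ l)).
      rewrite -E'; clear; move: (9 * _)%N (d1 * _)%N (d2 * _)%N => u v t; lia.
    by rewrite !leq_add.
  by clear; move: (perrin n) => p; lia.
have Pq : (perrin n < N.to_nat sieve_modulus)%N.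
  by apply: ltn_trans Psmall _; rewrite /sieve_modulus; lia.
have aE : a = perrin n.
  have := period_a (N.Div0.mod_same sieve_modulus).
  by rewrite Nat2N.id /a modn_mod (modn_small Pq).
have -> : N.ltb (N.of_nat a) 2000000 by rewrite aE; lia.
have l13 : N.of_nat l \in [:: 1; 2; 3]%num.
  by move: l_gt0 l3; case: (l) => [|[|[|[|]]]].
have m3 : (m < 3)%N by lia.
move=> /rangeNP/(_ _ d2_lt) /allP/(_ _ l13) /rangeNP/(_ _ m3).
have -> : palindrome_exp sieve_modulus (N.of_nat a) (N.of_nat l) (N.of_nat m) (N.of_nat d1) (N.of_nat d2).
  by apply: (palindrome_eq_mod E (period_a (N.Div0.mod_same sieve_modulus))); apply: exp10_mod.
case: ifP => [/N.eqb_eq|_]; first by rewrite aE; lia.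
case: ifP => h1; last by lia.
(* A Perrin number below 1000 cannot have an index of at least 20000, because [P_k >= k] from
   [k = 7] on. *)
move=> h2; have n20 : (N.to_nat 20000 <= n)%N by apply: leq_trans (leq_mod n L); lia.
have pge k : (7 <= k)%N -> (k <= perrin k)%N.
  move=> /subnKC <-; move: (k - 7)%N => j.
  suff [] : [/\ 7 + j <= perrin (7 + j), 7 + j.+1 <= perrin (7 + j.+1) & 7 + j.+2 <= perrin (7 + j.+2)]%N by [].
  elim: j => // j [h3 h4 h5]; split=> //.
  have -> : perrin (7 + j.+3) = (perrin (7 + j.+1) + perrin (7 + j))%N by rewrite !addnS perrinS.
  lia.
by have := pge n; rewrite aE in h1; lia.
Qed.
End Sieve.

(** * Further moduli for the surviving classes *)

Lemma perrin_residue q p r n : shift_pow q p = (1%num, 0%num, 0%num) ->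
  (n %% Pos.to_nat p = Pos.to_nat r)%N -> perrin n = N.to_nat (perrin_N q r) %[mod N.to_nat q].
Proof. by move=> hp hn; rewrite (perrin_periodic n hp) hn; apply: perrin_value. Qed.

(** Here [n] is congruent to [p - nu] modulo the period [p], and the finite check gives the residue
    -1 at these four indices. *)
Lemma perrin_minus_one_mod q p v n : shift_pow q p = (1%num, 0%num, 0%num) ->
  all (fun v => N.ltb (N.of_nat v.1.1) (N.pos p) &&
    N.eqb (perrin_N q (Pos.sub p (Pos.of_nat v.1.1))) (N.pred q)) minus_one_indices ->
  v \in minus_one_indices -> (Pos.to_nat p %| n + v.1.1)%N ->
  perrin n = N.to_nat (N.pred q) %[mod N.to_nat q].
Proof.
move=> hp /allP h hv /dvdnP[k e]; have /andP[h1 /N.eqb_eq <-] := h _ hv.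
have v0 : (0 < v.1.1)%N by move: hv; rewrite !inE => /or4P[] /eqP ->.
have k0 : (0 < k)%N by case: k e => // /eqP; rewrite mul0n addn_eq0 => /andP[_ /eqP e]; rewrite e in v0.
apply: perrin_residue hp _.
have id1 : Pos.to_nat (Pos.of_nat v.1.1) = v.1.1 by apply: Nat2Pos.id; lia.
have lt : (v.1.1 < Pos.to_nat p)%N by move/N.ltb_lt: h1; move: v.1.1 => u; clear; lia.
have -> : Pos.to_nat (Pos.sub p (Pos.of_nat v.1.1)) = (Pos.to_nat p - v.1.1)%N.
  by rewrite Pos2Nat.inj_sub ?id1 //; apply/Pos2Nat.inj_lt; rewrite id1; lia.
have -> : n = (k.-1 * Pos.to_nat p + (Pos.to_nat p - v.1.1))%N.
  by move: e lt v0; rewrite -{1}(prednK k0) mulSn; move: (k.-1 * Pos.to_nat p)%N (Pos.to_nat p) v.1.1 => t r u; clear; lia.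
by rewrite modnMDl modn_small //; lia.
Qed.

Definition nine_mod (q a l m : N) := palindrome_exp q a l m 9 8.

(** [n = 10171] modulo 21000 gives [n = 3171] modulo 7000, a period modulo 21001; the lengths [m]
    run over a period 250 of the powers of 10. *)
Lemma sieve_short_check :
  all (fun m => ~~ nine_mod 21001 (perrin_N 21001 3171) 3 m) (rangeN 250).
Proof. by vm_compute. Qed.

Lemma no_short_palindrome n m : (n %% Pos.to_nat 21000 = Pos.to_nat 10171)%N ->
  ~ palindrome_eq (perrin n) 3 m 9 8.
Proof.
move=> hn E; have m250 : (m %% 250 < 250)%N by rewrite ltn_pmod.
have hp : shift_pow 21001 7000 = (1%num, 0%num, 0%num) by vm_compute.
have hn' : (n %% Pos.to_nat 7000 = Pos.to_nat 3171)%N by lia.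
have := palindrome_expP (t := 250) E (perrin_residue hp hn') erefl.
by apply/negP; have := rangeNP sieve_short_check m250.
Qed.

(* Classes of [(l, m)] modulo 250, the order of 10 modulo 21001. *)
Definition classes21001 : seq (N * N) := [:: (249, 1); (125, 249)]%num.

(** Because [gcd(60, 250) = 10], the classes modulo 60 restrict those modulo 250 only through their
    residues [c1], [c2] modulo 10. *)
Definition sieve_class21001 (c1 c2 : N) := all (fun i => all (fun j =>
    let l := N.add c1 (N.mul 10 i) in let m := N.add c2 (N.mul 10 j) in
    if nine_mod 21001 21000 l m then (l, m) \in classes21001 else true)
  (rangeN 25)) (rangeN 25).

Lemma sieve_long_check :
  all (fun c => sieve_class21001 c.1 c.2) [:: (9, 1); (3, 7); (5, 9); (5, 3)]%num.
Proof. by vm_compute. Qed.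

(* The surviving class [l = 375], [m = 749] modulo 1500 is killed by 525001, for
   which the Perrin period divides 525000 and 10 has order 262500. *)
Lemma exceptional_check : all (fun i =>
    ~~ nine_mod 525001 525000 375 (N.add 749 (N.mul 1500 i))) (rangeN 175).
Proof. by vm_compute. Qed.

Section Long.
Variables (n l m : nat) (v : nat * int * int).
Hypotheses (E : palindrome_eq (perrin n) l m 9 8) (hv : v \in minus_one_indices).
Hypothesis hn : (Pos.to_nat 21000 %| n + v.1.1)%N.

Lemma nine_palindrome_eq :
  (9 * perrin n + 9 + 10 ^ (l + m) = 9 * 10 ^ (2 * l + m) + 10 ^ l)%N.
Proof.
move: E; rewrite /palindrome_eq mul2n -addnn -addnA !expnD.
move: (10 ^ l * 10 ^ m)%N (10 ^ l)%N => y x.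
by move: (x * y)%N => z; clear; lia.
Qed.

(** [9 (P_n + 1)] is a combination of [10^(2l+m)], [10^l] and [10^(l+m)], all multiples of [5^l]. *)
Lemma five_power_dvd : (5 ^ (l - 1) %| n + v.1.1)%N.
Proof.
apply: perrin_minus_one_5adic hv _ _; first by apply: dvdn_trans hn; rewrite /dvdn; lia.
rewrite -(@Gauss_dvdr _ 9) ?coprimeXl //.
have : (5 ^ l %| 9 * (perrin n + 1) + 10 ^ (l + m))%N.
  rewrite mulnDr muln1 nine_palindrome_eq.
  have d10 k : (5 ^ l %| 10 ^ (l + k))%N.
    by rewrite expnD dvdn_mulr // (expnMn 2 5 l) dvdn_mull.
  by rewrite dvdn_add ?dvdn_mull // ?mul2n -?addnn -?addnA ?d10 // -[X in (10 ^ X)%N]addn0 d10.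
rewrite dvdn_addl // expnD dvdn_mulr // (expnMn 2 5 l) dvdn_mull //.
Qed.

End Long.

Section Exceptional.
Variables (n l m : nat) (v : nat * int * int).
Hypotheses (E : palindrome_eq (perrin n) l m 9 8) (hv : v \in minus_one_indices).
Hypothesis hn : (Pos.to_nat 21000 %| n + v.1.1)%N.

Lemma no_exceptional : N.of_nat l = 375%num -> (m %% N.to_nat 1500 = 749)%N -> False.
Proof.
move=> l375 hm.
(* For [l = 375] the 5-adic bound supplies far more than [5^5], which raises the known modulus of
   [n + nu] from 21000 to [168 * 5^5 = 525000]. *)
have d5 : (Pos.to_nat 525000 %| n + v.1.1)%N.
  have h5 : (5 ^ 5 %| n + v.1.1)%N.
    apply: dvdn_trans (five_power_dvd E hv hn); rewrite dvdn_exp2l //; lia.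
  have h168 : (168 %| n + v.1.1)%N by apply: dvdn_trans hn; rewrite /dvdn; lia.
  have -> : Pos.to_nat 525000 = (168 * 5 ^ 5)%N by lia.
  by rewrite Gauss_dvd ?h168 // coprimeXr.
have hp : shift_pow 525001 525000 = (1%num, 0%num, 0%num) by vm_compute.
have hc : all (fun v => N.ltb (N.of_nat v.1.1) 525000 &&
    N.eqb (perrin_N 525001 (Pos.sub 525000 (Pos.of_nat v.1.1))) (N.pred 525001)) minus_one_indices.
  by vm_compute.
have P1 := perrin_minus_one_mod hp hc hv d5.
clear hp hc; have e : N.pred 525001 = 525000%num by [].
rewrite e in P1; pose t := N.to_nat 262500.
have ht : pow10_mod 525001 (N.of_nat t) = N.modulo 1 525001 by rewrite N2Nat.id; vm_compute.
have := palindrome_expP (t := t) E P1 ht; apply/negP; clear P1.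
have -> : (l %% t)%N = l by apply: modn_small; rewrite /t; lia.
rewrite l375.
have hi : (m %% t %/ N.to_nat 1500 < 175)%N by rewrite /t; lia.
have -> : N.of_nat (m %% t) = N.add 749 (N.mul 1500 (N.of_nat (m %% t %/ N.to_nat 1500))).
  by move: hm; rewrite /t; lia.
exact: (rangeNP exceptional_check hi).
Qed.
End Exceptional.

Lemma no_long_palindrome n l m v : palindrome_eq (perrin n) l m 9 8 ->
  v \in minus_one_indices -> (Pos.to_nat 21000 %| n + v.1.1)%N -> (4 <= l)%N ->
  [\/ l %% 60 = 59 /\ m %% 60 = 1, l %% 60 = 3 /\ m %% 60 = 37,
      l %% 60 = 15 /\ m %% 60 = 29 | l %% 60 = 55 /\ m %% 60 = 53]%N -> False.
Proof.
move=> E hv hn l4 cls.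
have hp : shift_pow 21001 7000 = (1%num, 0%num, 0%num) by vm_compute.
have hc : all (fun v => N.ltb (N.of_nat v.1.1) 7000 &&
    N.eqb (perrin_N 21001 (Pos.sub 7000 (Pos.of_nat v.1.1))) (N.pred 21001)) minus_one_indices.
  by vm_compute.
have d7 : (Pos.to_nat 7000 %| n + v.1.1)%N by apply: dvdn_trans hn; rewrite /dvdn; lia.
have P1 := perrin_minus_one_mod hp hc hv d7; clear hp hc d7.
have e21 : N.pred 21001 = 21000%num by [].
rewrite e21 in P1.
have p250 := palindrome_expP (t := 250) E P1 erefl; clear P1.
rewrite -/(nine_mod 21001 21000 _ _) in p250.
have c10 : (N.of_nat (l %% 10), N.of_nat (m %% 10)) \in [:: (9, 1); (3, 7); (5, 9); (5, 3)]%num.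
  have [h1 h2] : (l %% 10 = l %% 60 %% 10 /\ m %% 10 = m %% 60 %% 10)%N by lia.
  by rewrite h1 h2; case: cls => -[-> ->].
have r25 k : (k %% 250 %/ 10 < 25)%N by clear; lia.
have e k : N.add (N.of_nat (k %% 10)) (N.mul 10 (N.of_nat (k %% 250 %/ 10))) = N.of_nat (k %% 250) by clear; lia.
have : sieve_class21001 (N.of_nat (l %% 10)) (N.of_nat (m %% 10)) := allP sieve_long_check _ c10.
move=> /rangeNP/(_ _ (r25 l)) /rangeNP/(_ _ (r25 m)).
rewrite !e; cbv zeta; rewrite p250 !inE !xpair_eqE.
have cases : (l %% 250 = 249 /\ m %% 250 = 1 \/ l %% 250 = 125 /\ m %% 250 = 249)%N -> False.
  move=> h.
  (* Modulo [lcm(60, 250) = 1500] two classes of [(l, m)] remain. The first has [l = -1], so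
     [l >= 1499]; the second has [l = 375], [m = 749], where either [l] is 375 itself or
     [l >= 1875]. *)
  have [l1499|[l375 m749]] : (1499 <= l \/ l = 375 /\ m %% 1500 = 749)%N.
    by case: h => -[h1 h2]; case: cls => -[h3 h4]; clear -l4 h1 h2 h3 h4; lia.
  - apply: (nine_palindrome_large (nine_palindrome_eq E) l1499).
    have n0 : (0 < n + v.1.1)%N.
      by move: hv; rewrite !inE addn_gt0 => /or4P[] /eqP ->; rewrite orbT.
    have := dvdn_leq n0 (five_power_dvd E hv hn).
    have v29 : (v.1.1 <= 29)%N by move: hv; rewrite !inE => /or4P[] /eqP ->.
    have -> : (l - 1 = (l - 2).+1)%N by lia.
    rewrite expnS; have : (5 ^ 3 <= 5 ^ (l - 2))%N by rewrite leq_pexp2l //; lia.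
    by move: (5 ^ (l - 2))%N v.1.1 v29 => x u; clear; lia.
  - by apply: (no_exceptional E hv hn); lia.
by case/orP=> /andP[/eqP h1 /eqP h2]; apply: cases; [left | right]; split; lia.
Qed.

Lemma perrin_palindrome n l m (d1 d2 : 'I_10) : (0 < l)%N -> (0 < d1)%N ->
  palindrome_eq (perrin n) l m d1 d2 -> perrin n = 22%N.
Proof.
move=> l0 d10 E; have dl1 := ltn_ord d1; have dl2 := ltn_ord d2.
case: (leqP l 3) => l3.
  case: (leqP (l + m) 3) => lm; first exact: (sieve_tiny_value E l0 d10 dl1 dl2 l3 lm).
  have [e1 e2 e3 hn] := sieve_short_class E l0 d10 dl1 dl2 l3 lm.
  by move: E; rewrite e1 e2 e3 => E; case: (no_short_palindrome hn E).
have [e1 e2 [v hv hn] cls] := sieve_long_classes E l0 d10 dl1 dl2 l3.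
by move: E; rewrite e1 e2 => E; case: (no_long_palindrome E hv hn l3 cls).
Qed.

Local Close Scope ring_scope.

Theorem theorem1p1 (N : nat) :
  (exists n : nat, N = perrin n) /\ palindromic_concatenation N <-> N = 22.
Proof.
split=> [[[n ->] [l [m [d1 [d2 [l0 d10 E]]]]]] | ->].
  by apply: (perrin_palindrome l0 d10); rewrite E; apply: palindromic_concatenationP.
split; first by exists 11.
by exists 1, 0, (Ordinal (isT : 2 < 10)), ord0.
Qed.
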